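(* Assume Jensen's principle $\diamondsuit$. Then there is a weird space $X$ such that $X$ is hereditarily separable and hereditarily Lindelöf and $X$ fails the Complex Stone-Weierstrass Property (CSWP).
   Context: All spaces are Hausdorff. A space is scattered if every nonempty subspace has an isolated point. A perfect set in a space is a nonempty closed subset with no isolated points. A space is totally disconnected if all its connected components are singletons. A space $X$ is weird iff $X$ is compact and not scattered, and there is no $P\subseteq X$ such that $P$ is perfect and totally disconnected. A space is hereditarily separable (respectively hereditarily Lindelöf) if every subspace of it is separable (respectively Lindelöf). For compact $X$, $C(X)=C(X,\mathbb{C})$ is the algebra of continuous complex-valued functions on $X$ with the supremum norm. $X$ has the CSWP iff every subalgebra $\mathcal{A}$ of $C(X)$ which separates points and contains the constant functions is dense in $C(X)$. *)

(* Defs.v *)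
From HB Require Import structures.
From mathcomp Require Import all_boot all_order all_algebra.
From mathcomp Require Import all_classical all_reals all_analysis.
From mathcomp Require Import wochoice complex.
Import Order.TTheory GRing.Theory Num.Theory.
Import numFieldNormedType.Exports.

Set Implicit Arguments.
Unset Strict Implicit.
Unset Printing Implicit Defensive.

Local Open Scope classical_set_scope.
Local Open Scope ring_scope.

Section Diamond.
Context {d : Order.disp_t} (W : orderType d).
Implicit Types (a b c : W) (A B C S : set W).

(* The ordinal a is identified with the set of its predecessors. *)
Definition initial_segment a : set W := [set b | (b < a)%O].

(* This determines W up to order isomorphism. *)
Definition is_omega1 : Prop :=
  [/\ well_order (<=%O : rel W), ~ countable [set: W]
    & forall a, countable (initial_segment a)].

Definition unbounded C : Prop := forall a, exists2 c, C c & (a < c)%O.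

Definition limit_of C a : Prop :=
  initial_segment a !=set0 /\
  forall b, (b < a)%O -> exists2 c, C c & (b < c < a)%O.

Definition club C : Prop := unbounded C /\ forall a, limit_of C a -> C a.

Definition stationary S : Prop := forall C, club C -> S `&` C !=set0.

Definition diamond_sequence (D : W -> set W) : Prop :=
  (forall a, D a `<=` initial_segment a) /\
  forall A, stationary [set a | A `&` initial_segment a = D a].

End Diamond.

Definition Jensen_diamond : Prop :=
  exists (d : Order.disp_t) (W : orderType d),
    is_omega1 W /\ exists D : W -> set W, diamond_sequence D.

Section Spaces.
Implicit Type X : topologicalType.

Definition scattered X : Prop :=
  forall A : set X, A !=set0 -> isolated A !=set0.

(* perfect_set allows the empty set. *)
Definition weird X : Prop :=
  [/\ compact [set: X], ~ scattered X
    & ~ exists P : set X,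
        [/\ P !=set0, perfect_set P & totally_disconnected P]].

Definition separable_space X : Prop := exists2 D : set X, countable D & dense D.

Definition lindelof_space X : Prop :=
  forall U : set (set X), U `<=` open -> \bigcup_(V in U) V = [set: X] ->
  exists U' : set (set X),
    [/\ U' `<=` U, countable U' & \bigcup_(V in U') V = [set: X]].

(* set_type A carries the subspace topology, unlike subspace A, in which the
   points outside A are isolated. *)
Definition hereditarily_separable X : Prop :=
  forall A : set X, separable_space (set_type A).

Definition hereditarily_lindelof X : Prop :=
  forall A : set X, lindelof_space (set_type A).

End Spaces.

Section CSWP.
Context (R : realType) (X : topologicalType).
Implicit Types (f g : X -> R[i]^o) (A : set (X -> R[i]^o)).

(* C(X); R[i]^o is the complex field with its norm topology. *)
Definition continuous_functions : set (X -> R[i]^o) :=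
  [set f | continuous f].

(* Meaningful for bounded f, in particular for f in C(X) when X is compact. *)
Definition sup_norm f : R := sup (range (fun x => Normc.normc (f x))).

Definition is_subalgebra A : Prop :=
  [/\ A `<=` continuous_functions,
      A 0,
      forall f g, A f -> A g -> A (f + g),
      forall (c : R[i]) f, A f -> A (c *: f)
    & forall f g, A f -> A g -> A (f * g)].

Definition separates_points A : Prop :=
  forall x y : X, x != y -> exists2 f, A f & f x != f y.

Definition contains_constants A : Prop := forall c : R[i], A (cst c).

Definition sup_norm_dense A : Prop :=
  forall f, continuous_functions f ->
  forall e : R, 0 < e -> exists2 g, A g & sup_norm (f - g) < e.

Definition CSWP : Prop :=
  forall A, is_subalgebra A -> separates_points A -> contains_constants A ->
  sup_norm_dense A.

End CSWP.

(* Main.v *)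
Require Import Defs.
From mathcomp Require Import all_boot all_order all_algebra.
From mathcomp Require Import all_classical all_reals all_analysis.
From mathcomp Require Import measurable_realfun complex ring lra.
Import Order.TTheory GRing.Theory Num.Theory.
Import numFieldNormedType.Exports.

(** The space X is the inverse limit of compact metric spaces X_a, a < omega_1, starting from the unit circle. At stage a at most one point x of X_a is blown up to the interval [0, 1]: X_(a+1) is the closure of the graph of a bounded continuous F on X_a minus x whose cluster set at x is [0, 1]. Diamond proposes at each stage a countable set E_a of X_a; points of E_a are never split later, and if x lies in the closure of (the lift of) an E_c with c <= a, then F already clusters to all of [0, 1] along it. Hence the closure of E_a in X is the full preimage of its closure in X_a, so that left-separated sequences and closed sets that are not G_delta are excluded; this gives hereditary separability and the hereditary Lindelof property. A perfect set H contains a countable dense set that is guessed at some stage a and whose closure in X_a is uncountable, so x can be chosen there; H then contains the whole fibre of x, which is a nondegenerate continuum.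

The function F is a pointwise limit of bounded polynomials in a function h peaking at x: F = sum of eps_m h^(n_m), where the partial sums of eps_m sweep through [0, 1] with vanishing steps and n_m grows very fast. By Bishop's theorem on peak sets within peak sets, every point of every X_a is a peak point of the algebra A_a generated by the coordinates. Along a section of X -> circle all coordinates are therefore iterated bounded pointwise limits of polynomials in z, and by dominated convergence they stay orthogonal to z: the algebra generated by the coordinates separates points but stays at distance 1 from the conjugate of z. *)

Set Implicit Arguments.
Unset Strict Implicit.
Unset Printing Implicit Defensive.

Local Open Scope classical_set_scope.
Local Open Scope ring_scope.

(** * Countable ordinals and guessing *)

(** Two demands on F compete. It must oscillate at x through all of [0, 1], even along any guessed
    set that clusters at x; yet its restriction to the section must be a bounded limit of
    polynomials at every point, x included. Powers of a peak function reconcile them: each is close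
    to 1 near x and can be made negligible away from x. Hence every point of every stage has to stay
    a peak point. New coordinates over a split point are real, and 1 - (s - s0)^2 peaks at s0 within
    [0, 1].

    Points of guessed sets are never split, so each has exactly one point of X above it, and
    nearness to a guessed set at its stage lifts to nearness to the same set in X. Points to split
    remain available: only countably many points of a stage lie over guessed points, whereas the
    closure of a nonempty countable set without isolated points is uncountable.

    Fibres are connected because each stage adds a point or an interval over each point, and by
    compactness a separation cannot first appear at a limit stage. A perfect set containing the
    fibre of a split point is therefore not totally disconnected. *)

Lemma countable_bigcup_countable (I T : Type) (A : set I) (F : I -> set T) :
  countable A -> (forall i, A i -> countable (F i)) -> countable (\bigcup_(i in A) F i).
Proof. by move=> cA cF; apply: bigcup_countable => // i /set_mem/cF. Qed.

Lemma countableU (T : Type) (A B : set T) : countable A -> countable B -> countable (A `|` B).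
Proof.
move=> cA cB; rewrite (_ : A `|` B = \bigcup_(b in [set: bool]) if b then A else B).
  by apply: countable_bigcup_countable => // -[].
apply/seteqP; split=> x; last by case=> -[] _ ?; [left|right].
by case=> ?; [exists true|exists false].
Qed.

Lemma countable_image (S T : Type) (f : S -> T) (A : set S) : countable A -> countable (f @` A).
Proof. exact: sub_countable (card_image_le f A). Qed.

Section Omega1.
Local Open Scope order_scope.
Local Open Scope classical_set_scope.
Context {d : Order.disp_t} (W : orderType d).
Hypothesis HW : is_omega1 W.
Implicit Types (a b c : W) (A B : set W).

Lemma omega1_min A : A !=set0 -> exists2 a, A a & forall b, A b -> a <= b.
Proof.
have [wo _ _] := HW; move=> [x Ax].
have [|m [[mA mlow] _]] := wo (mem A); first by exists x; exact/mem_set.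
exists m; first exact/set_mem.
by move=> b Ab; apply: mlow; exact/mem_set.
Qed.

Lemma omega1_ind (P : W -> Prop) :
  (forall a, (forall b, b < a -> P b) -> P a) -> forall a, P a.
Proof.
move=> step a; apply: contrapT => nPa.
have [m nPm mmin] := @omega1_min [set x | ~ P x] (ex_intro _ a nPa).
apply: nPm; apply: step => b bm; apply: contrapT => /mmin.
by rewrite leNgt bm.
Qed.

Lemma omega1_wf : well_founded (fun a b : W => a < b).
Proof. by apply: omega1_ind => a IH; constructor. Qed.

Lemma countable_le a : countable [set b | b <= a].
Proof.
have [_ _ ci] := HW.
rewrite (_ : [set _ | _] = initial_segment a `|` [set a]).
  by apply: countableU => //; exact: countable1.
apply/seteqP; split=> b /=; rewrite /initial_segment/= le_eqVlt.
  by move=> /orP[/eqP|]; [right|left].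
by case=> [->|->]; rewrite ?eqxx ?orbT.
Qed.

Lemma countable_bounded A : countable A -> exists a, forall b, A b -> b < a.
Proof.
move=> cA; apply: contrapT => nex; have [_ + _] := HW; apply.
rewrite (_ : setT = \bigcup_(a in A) [set b | b <= a]).
  by apply: countable_bigcup_countable => // *; exact: countable_le.
apply/esym/seteqP; split=> // b _; apply: contrapT => nb; apply: nex.
exists b => c Ac; rewrite ltNge; apply/negP => bc; apply: nb; by exists c.
Qed.

Lemma omega1_succ a : exists2 b, a < b & forall c, a < c -> b <= c.
Proof.
have [b hb] := countable_bounded (@countable1 _ a).
have [|m ? ?] := @omega1_min [set x | a < x]; last by exists m.
by exists b; exact: hb.
Qed.

(** Recursion with choice: [G a f t] says that [t] is admissible at [a] given the values of [f]
    below [a]. The first hypothesis makes [G] blind to [f] from [a] on, so the recursion may pad the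
    function with [t0]. *)
Lemma omega1_rec (T : Type) (t0 : T) (G : W -> (W -> T) -> T -> Prop) :
  (forall a f g t, (forall b, b < a -> f b = g b) -> G a f t -> G a g t) ->
  (forall a f, (forall b, b < a -> G b f (f b)) -> exists t, G a f t) ->
  exists f, forall a, G a f (f a).
Proof.
move=> congr step.
have /choice[h hP] (af : W * (W -> T)) :
    exists t, (exists t, G af.1 af.2 t) -> G af.1 af.2 t.
  by case: (pselect (exists t, G af.1 af.2 t)) => [[t ?]|?]; [exists t|exists t0].
pose ext a (r : forall b, b < a -> T) b : T :=
  if pselect (b < a) is left ba then r b ba else t0.
pose F a (r : forall b, b < a -> T) : T := h (a, ext a r).
pose f := Fix omega1_wf (fun=> T) F.
have fE a : f a = h (a, fun b => if b < a then f b else t0).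
  rewrite /f Fix_eq; last first.
    by move=> x r1 r2 r12; rewrite (_ : r1 = r2)//; do 2 apply: functional_extensionality_dep => ?.
  congr (h (a, _)); apply/funext => b; rewrite /ext.
  by case: pselect => [/= ->//|/negP/negbTE ->].
exists f; apply: omega1_ind => a IH; rewrite fE.
apply: (congr _ (fun b => if b < a then f b else t0)); first by move=> b ->.
apply: (hP (a, _)) => /=; apply: step => b ba; rewrite ba.
apply: congr (IH b ba) => c cb; by rewrite (lt_trans cb ba).
Qed.

Lemma omega1_club (g : W -> W) a0 : club [set a | a0 < a /\ forall b, b < a -> g b < a].
Proof.
split=> [a|a [[b0 b0a] lim]]; last first.
  split=> [|b ba].
    by have [c [a0c _] /andP[_ ca]] := lim _ b0a; exact: lt_trans ca.
  have [c [_ gc] /andP[bc ca]] := lim _ ba.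
  by apply: lt_trans ca; exact: gc.
have /choice[s sP] (x : W) : exists y, forall z, z <= x -> z < y /\ g z < y.
  have [y hy] := countable_bounded (countableU (countable_le x)
     (countable_image g (countable_le x))).
  by exists y => z zx; split; apply: hy; [left|right; exists z].
pose x := fix x n := if n is m.+1 then s (x m) else Order.max a a0.
have [y0 hy0] : exists y, forall n, x n < y.
  have [y hy] := countable_bounded (countable_image x (countableP setT)).
  by exists y => n; apply: hy; exists n.
have [c hc cmin] := @omega1_min [set y | forall n, x n < y] (ex_intro _ y0 hy0).
exists c => /=; last by apply: le_lt_trans (hc 0%N); rewrite /= le_max lexx.
split; first by apply: le_lt_trans (hc 0%N); rewrite /= le_max lexx orbT.
move=> b bc; have [n bn] : exists n, b <= x n.
  apply: contrapT => nex; have : c <= b; last by rewrite leNgt bc.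
  by apply: cmin => n; rewrite ltNge; apply/negP => h; apply: nex; exists n.
by have [_ h] := sP (x n) b bn; exact: lt_trans h (hc n.+1).
Qed.

Lemma omega1_increasing a0 : exists e : nat -> W, injective e /\ forall n, a0 < e n.
Proof.
have /choice[s sP] (x : W) : exists y, x < y.
  by have [y ? _] := omega1_succ x; exists y.
pose e := fix e n := if n is m.+1 then s (e m) else s a0.
have eS n : e n < e n.+1 by exact: sP.
have emono m n : (m < n)%N -> e m < e n.
  elim: n => // n IH; rewrite ltnS leq_eqVlt => /orP[/eqP->//|/IH h].
  exact: lt_trans h (eS n).
exists e; split=> [m n emn|].
  by case: (ltngtP m n) => // /emono; rewrite emn ltxx.
by elim=> [|n IH]; [exact: sP|exact: lt_trans IH (eS n)].
Qed.

Section Ranked.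
Context {T : Type} (rk : T -> W).
Hypothesis rkP : forall a, countable [set t | rk t <= a].

(* Rank by rank, the code of [t] avoids the countably many codes already used. *)
Lemma ranked_coding : exists c : T -> W, injective c.
Proof.
have [a0 _] := countable_bounded (@countable0 W).
pose G a (f : W -> T -> W) (h : T -> W) :=
  (forall t t', rk t = a -> rk t' = a -> h t = h t' -> t = t') /\
  forall t s, rk t = a -> rk s < a -> h t <> f (rk s) s.
have [||f fP] := @omega1_rec _ (fun=> a0) G.
- move=> a f g h fg [h1 h2]; split=> // t s ta sa; rewrite -fg//; exact: h2.
- move=> a f _.
  have [b0 hb0] := countable_bounded
    (countable_image (fun s => f (rk s) s) (rkP a)).
  have [e [einj eb]] := omega1_increasing b0.
  have /countable_injP[i iinj] := rkP a.
  exists (e \o i); split=> [t t' ta t'a /einj/iinj|t s ta sa].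
    by apply; apply/mem_set; rewrite /= ?ta ?t'a.
  move=> eq; have := eb (i t); rewrite -[e (i t)]/((e \o i) t) eq ltNge => /negP; apply.
  by apply/ltW/hb0; exists s => //; exact: ltW.
exists (fun t => f (rk t) t) => t s ts.
have [h1 h2] := fP (rk t); have [h3 h4] := fP (rk s).
case: (ltgtP (rk t) (rk s)) => [lt|gt|e].
- by case: (h4 s t erefl lt).
- by case: (h2 t s erefl gt).
- by apply: h1 => //; rewrite {2}e.
Qed.

(** The guess is made on codes. Taking [a] closed under [h], which dominates both [g] and the codes
    of the elements of each rank, puts the code of every element of rank below [a] below [a], where
    the diamond sequence decides it. *)
Lemma diamond_guess (D : W -> set W) : diamond_sequence D ->
  exists G : W -> set T, forall (A : set T) (g : W -> W) a0,
    exists a, [/\ a0 < a, forall b, b < a -> g b < a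
                & forall t, rk t < a -> (G a t <-> A t)].
Proof.
move=> [_ DS]; have [c cinj] := ranked_coding.
exists (fun a t => D a (c t)) => A g a0.
have /choice[h hP] (a : W) : exists y, g a < y /\ forall t, rk t <= a -> c t < y.
  have [y hy] := countable_bounded (countableU (@countable1 _ (g a))
    (countable_image c (rkP a))).
  by exists y; split=> [|t ta]; apply: hy; [left|right; exists t].
have [a [/= aD [a0a ha]]] := DS (c @` A) _ (omega1_club h a0).
exists a; split=> // [b /ha|t ta]; first by apply: lt_trans; case: (hP b).
have cta : c t < a by apply: lt_trans (ha _ ta); case: (hP (rk t)) => _; apply.
rewrite -aD; split=> [[[s As /cinj <-]//]|At]; split=> //; by exists t.
Qed.

End Ranked.

End Omega1.

(** * Complex modulus *)

(* [Normc.normc] at type [R]: its library type is a join structure that [lra] does not see through. *)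
Definition modc {R : rcfType} (x : R[i]) : R := Normc.normc x.

Section ComplexModulus.
Context {R : realType}.
Implicit Types (x y z : R[i]) (e : R).
Local Notation N := (@modc R).

Lemma modc0 : N 0 = 0. Proof. exact: Normc.normc0. Qed.
Lemma modc1 : N 1 = 1. Proof. exact: Normc.normc1. Qed.
Lemma modcM x y : N (x * y) = N x * N y. Proof. exact: Normc.normcM. Qed.

Lemma modc_triangle x y : N (x + y) <= N x + N y.
Proof. exact: le_normcD. Qed.

Lemma modcN x : N (- x) = N x.
Proof. exact: normcN. Qed.

Lemma modc_ge0 x : 0 <= N x.
Proof. by rewrite /modc; case: x => a b; exact: sqrtr_ge0. Qed.

Lemma modc_distC x y : N (x - y) = N (y - x).
Proof. by rewrite -modcN opprB. Qed.

Lemma modc_dist_triangle y x z : N (x - z) <= N (x - y) + N (y - z).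
Proof. by apply: le_trans (modc_triangle _ _); rewrite addrA subrK. Qed.

Lemma modc_eq0 x : (N x == 0) = (x == 0).
Proof.
by apply/eqP/eqP => [/Normc.eq0_normc//|->]; rewrite modc0.
Qed.

Lemma modc_gt0 x : (0 < N x) = (x != 0).
Proof. by rewrite lt_neqAle modc_ge0 andbT eq_sym modc_eq0. Qed.

Lemma modcX x n : N (x ^+ n) = N x ^+ n.
Proof.
by elim: n => [|n IH]; rewrite ?expr0 ?modc1// !exprS modcM IH.
Qed.

Lemma modc_real (a : R) : N a%:C%C = `|a|.
Proof. by rewrite /modc /= expr0n /= addr0 sqrtr_sqr. Qed.

Lemma normr_Re_le x : `|complex.Re x| <= N x.
Proof.
rewrite /modc; case: x => a b /=; rewrite -sqrtr_sqr ler_wsqrtr // lerDl; exact: sqr_ge0.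
Qed.

Lemma normr_Im_le x : `|complex.Im x| <= N x.
Proof.
rewrite /modc; case: x => a b /=; rewrite -sqrtr_sqr ler_wsqrtr // lerDr; exact: sqr_ge0.
Qed.

Lemma modc_le_ReIm x : N x <= `|complex.Re x| + `|complex.Im x|.
Proof.
rewrite /modc; case: x => a b /=; rewrite -[leRHS]ger0_norm ?addr_ge0// -sqrtr_sqr.
rewrite ler_wsqrtr // sqrrD !real_normK ?num_real//.
by rewrite lerD2r lerDl mulrn_wge0// mulr_ge0.
Qed.

Lemma modc_lerB_dist x y : N x - N y <= N (x - y).
Proof. by rewrite lerBlDr; apply: le_trans (modc_triangle _ _); rewrite subrK. Qed.

Definition cvgc (u : nat -> R[i]) (l : R[i]) :=
  forall e : R, 0 < e -> exists n0 : nat, forall n, (n0 <= n)%N -> N (u n - l) < e.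

Lemma cvgc_const l : cvgc (fun=> l) l.
Proof. by move=> e e0; exists 0%N => n _; rewrite subrr modc0. Qed.

Lemma cvgcD u v l m : cvgc u l -> cvgc v m -> cvgc (fun n => u n + v n) (l + m).
Proof.
move=> ul vm e e0; have e2 : 0 < e / 2 by lra.
have [n1 h1] := ul _ e2; have [n2 h2] := vm _ e2.
exists (maxn n1 n2) => n; rewrite geq_max => /andP[/h1 a /h2 b].
rewrite (_ : _ - _ = (u n - l) + (v n - m)); last by ring.
apply: le_lt_trans (modc_triangle _ _) _; lra.
Qed.

Lemma cvgcMl a u l : cvgc u l -> cvgc (fun n => a * u n) (a * l).
Proof.
move=> ul e e0; have Na := modc_ge0 a.
have [n0 h] := ul (e / (N a + 1)) ltac:(by apply: divr_gt0 => //; lra).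
exists n0 => n /h; rewrite -mulrBr modcM => H.
apply: le_lt_trans (_ : (N a + 1) * N (u n - l) < _).
  by rewrite ler_wpM2r ?modc_ge0//; lra.
by rewrite mulrC -ltr_pdivlMr //; lra.
Qed.

(* [R[i]] carries no completeness structure in the library. *)
Lemma cauchy_cvgc (u : nat -> R[i]) (r : nat -> R) :
  (forall e : R, 0 < e -> exists n, r n < e) ->
  (forall n m, (n <= m)%N -> N (u m - u n) <= r n) ->
  exists l, cvgc u l /\ forall n, N (l - u n) <= r n.
Proof.
move=> r0 ur.
have part (f : R[i] -> R) : (forall x y, `|f x - f y| <= N (x - y)) ->
    exists a : R, forall e : R, 0 < e ->
    exists n0 : nat, forall n, (n0 <= n)%N -> `|f (u n) - a| < e.
  move=> fN; have cv : cvgn (f \o u).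
    apply/cauchy_cvgP/cauchy_exP => e e0.
    have [n rn] := r0 e e0; exists (f (u n)), n => // m /= nm.
    rewrite /ball/= distrC; apply: le_lt_trans (fN _ _) _.
    exact: le_lt_trans (ur _ _ nm) rn.
  exists (limn (f \o u)) => e e0.
  have /cvgrPdist_lt/(_ e e0)[n0 _ h] := cv.
  by exists n0 => n /h/=; rewrite distrC.
have [a ha] := part (@complex.Re R) ltac:(by move=> x y; rewrite -raddfB; exact: normr_Re_le).
have [b hb] := part (@complex.Im R) ltac:(by move=> x y; rewrite -raddfB; exact: normr_Im_le).
have ul : cvgc u (a +i* b)%C.
  move=> e e0; have e2 : 0 < e / 2 by lra.
  have [n1 h1] := ha _ e2; have [n2 h2] := hb _ e2.
  exists (maxn n1 n2) => n; rewrite geq_max => /andP[/h1 h1n /h2 h2n].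
  apply: le_lt_trans (modc_le_ReIm _) _; rewrite !raddfB/=; lra.
exists (a +i* b)%C; split => // n; apply/ler_addgt0Pr => e e0.
have [m h] := ul e e0.
apply: le_trans (modc_dist_triangle (u (maxn m n)) _ _) _.
rewrite addrC; apply: lerD; first exact: ur (leq_maxr _ _).
by rewrite modc_distC; apply/ltW/h/leq_maxl.
Qed.

End ComplexModulus.

(** * A sequence sweeping through [0, 1] with vanishing steps *)

Section Sweep.
Context {R : realType}.

Lemma cos_lipschitz (a b : R) : a <= b -> `|cos b - cos a| <= b - a.
Proof.
move=> ab.
have dc (x : R) : x \in `]a, b[%R -> is_derive x 1%R cos (- sin x).
  by move=> _; exact: is_derive_cos.
have cc : {within `[a, b], continuous (@cos R)}.
  by apply: continuous_subspaceT => x; exact: continuous_cos.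
have [c _ ->] := MVT_segment ab dc cc.
rewrite normrM normrN (ger0_norm (_ : 0 <= b - a)) ?subr_ge0//.
by rewrite ler_piMl ?subr_ge0// ler_norml sin_geN1 sin_le1.
Qed.

Lemma sqrt_steps (m : nat) :
  0 <= Num.sqrt (m.+1%:R : R) - Num.sqrt m%:R <= (Num.sqrt (m.+1%:R))^-1.
Proof.
set a := Num.sqrt _; set b := Num.sqrt _.
have ba : b <= a by rewrite ler_wsqrtr// ler_nat.
have b0 : 0 <= b by exact: sqrtr_ge0.
have a0 : 0 < a by rewrite sqrtr_gt0 ltr0n.
rewrite subr_ge0 ba /= -[leRHS]mul1r ler_pdivlMr//.
have <- : a ^+ 2 - b ^+ 2 = 1.
  by rewrite !sqr_sqrtr ?ler0n// -natr1 addrAC subrr add0r.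
rewrite subr_sqr ler_wpM2l ?subr_ge0//; lra.
Qed.

(** The witness is (1 - cos (sqrt m)) / 2: the square roots are unbounded with steps tending to 0,
    and the cosine is 1-Lipschitz and periodic. *)
Lemma sweeping_sequence : exists S : nat -> R,
  [/\ S 0%N = 0, forall m, 0 <= S m <= 1,
      forall e : R, 0 < e -> exists n0, forall m, (n0 <= m)%N -> `|S m.+1 - S m| < e
    & forall (s e : R) n0, 0 <= s <= 1 -> 0 < e ->
        exists2 m, (n0 <= m)%N & `|S m - s| < e].
Proof.
pose r m : R := Num.sqrt m%:R.
pose S m : R := (1 - cos (r m)) / 2.
have SB m k : (m <= k)%N -> `|S k - S m| <= (r k - r m) / 2.
  move=> mk; have rmk : r m <= r k by rewrite ler_wsqrtr// ler_nat.
  have := cos_lipschitz rmk; rewrite -(normrN (cos _ - _)).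
  rewrite (_ : S k - S m = - (cos (r k) - cos (r m)) / 2); last by rewrite /S; lra.
  by rewrite normrM (ger0_norm (_ : 0 <= 2^-1)) ?invr_ge0//; lra.
have small e : 0 < e -> exists n0, forall m, (n0 <= m)%N -> r m.+1 - r m < e.
  move=> e0; exists (Num.bound (e^-1 ^+ 2)) => m hm.
  have /andP[_ /le_lt_trans] := sqrt_steps m; apply.
  rewrite -[ltRHS]invrK ltf_pV2 ?posrE ?invr_gt0// ?sqrtr_gt0 ?ltr0n//.
  rewrite -[ltLHS]ger0_norm ?invr_ge0 ?(ltW e0)// -sqrtr_sqr ltr_sqrt ?ltr0n//.
  apply: lt_le_trans (archi_boundP (sqr_ge0 _)) _; rewrite ler_nat; exact: leqW.
exists S; split.
- by rewrite /S /r sqrtr0 cos0 subrr mul0r.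
- move=> m; rewrite /S; have := cos_geN1 (r m); have := cos_le1 (r m); lra.
- move=> e e0; have [n0 h] := small e e0; exists n0 => m /h hm.
  apply: le_lt_trans (SB _ _ (leqnSn m)) _.
  have : 0 <= r m.+1 - r m by rewrite subr_ge0 ler_wsqrtr// ler_nat.
  lra.
move=> s e n0 s01 e0; have [n1 h1] := small e e0.
have [/andP[t0 tpi] ct] : 0 <= acos (1 - 2 * s) <= pi /\ cos (acos (1 - 2 * s)) = 1 - 2 * s.
  by apply: acos_def; lra.
pose n2 := maxn n0 n1.
(* [y] is a large solution of (1 - cos y) / 2 = s. With [m] the integer part of its square, [y] lies
   between [r m] and [r m.+1], hence is close to [r m]. *)
pose y := acos (1 - 2 * s) + n2.+1%:R * (2 * pi).
have y0 : n2.+1%:R <= y.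
  have p2 := pi_ge2 R.
  rewrite /y -[leLHS]mulr1; apply: le_trans (_ : n2.+1%:R * (2 * pi) <= _); last by lra.
  by rewrite ler_wpM2l ?ler0n//; lra.
have cy : cos y = 1 - 2 * s.
  rewrite /y; elim: (n2.+1) => [|k IH]; first by rewrite mul0r addr0.
  rewrite (_ : _ + _ = acos (1 - 2 * s) + k%:R * (2 * pi) + pi *+ 2).
    by rewrite cosD2pi.
  by rewrite -natr1; ring.
have yge : 0 <= y by apply: le_trans y0; rewrite ler0n.
have y2 : 0 <= y ^+ 2 by exact: sqr_ge0.
pose m := Num.truncn (y ^+ 2).
have /andP[m1 m2] : m%:R <= y ^+ 2 < m.+1%:R by exact: truncn_itv.
have rm : r m <= y.
  by rewrite -[y]ger0_norm// -sqrtr_sqr ler_wsqrtr.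
have rm1 : y <= r m.+1.
  by rewrite -[y]ger0_norm// -sqrtr_sqr ler_wsqrtr// ltW.
have n2m : (n2 <= m)%N.
  rewrite -ltnS -(ltr_nat R); apply: le_lt_trans m2.
  have : n2%:R <= (n2.+1%:R : R) by rewrite ler_nat.
  move=> h; apply: (le_trans h); apply: (le_trans y0).
  by rewrite expr2 ler_peMl//; apply: (le_trans _ y0); rewrite ler1n.
exists m; first by apply: leq_trans n2m; exact: leq_maxl.
have hy := cos_lipschitz rm.
have := h1 m (leq_trans (leq_maxr _ _) n2m).
have -> : S m - s = (cos y - cos (r m)) / 2 by rewrite /S cy; lra.
rewrite normrM (ger0_norm (_ : 0 <= 2^-1)) ?invr_ge0//; lra.
Qed.

End Sweep.

(** * A function sweeping through an interval *)

Lemma dependent_choice_rel (T : Type) (J : nat -> T -> Prop) (K : nat -> T -> T -> Prop) :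
  (exists x, J 0%N x) ->
  (forall m x, J m x -> exists y, K m x y /\ J m.+1 y) ->
  exists f : nat -> T, forall m, J m (f m) /\ K m (f m) (f m.+1).
Proof.
move=> [x0 J0] step.
have /choice[g gP] (mx : nat * T) : exists y, J mx.1 mx.2 ->
    K mx.1 mx.2 y /\ J mx.1.+1 y.
  case: (pselect (J mx.1 mx.2)) => [/step[y ?]|?]; last by exists mx.2.
  by exists y.
pose f := fix f n := if n is m.+1 then g (m, f m) else x0.
have Jf m : J m (f m) by elim: m => //= m /(gP (m, f m))[].
by exists f => m; split => //; have [] := gP (m, f m) (Jf m).
Qed.

Section HalfPowers.
Context {R : realType}.
Definition hp (m : nat) : R := 2^-1 ^+ m.

Lemma hp_gt0 m : 0 < hp m.
Proof. by rewrite exprn_gt0// invr_gt0. Qed.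

Lemma hpS m : hp m = 2 * hp m.+1.
Proof. by rewrite /hp exprS mulrA divff// mul1r. Qed.

Lemma hp_le m n : (m <= n)%N -> hp n <= hp m.
Proof.
move=> /subnK <-; elim: (n - m)%N => // k IH; rewrite addSn.
apply: le_trans IH; have := hpS (k + m); have := hp_gt0 (k + m).+1; lra.
Qed.

Lemma hp_le1 m : hp m <= 1.
Proof. by apply: le_trans (hp_le (leq0n m)) _; rewrite /hp expr0. Qed.

Lemma pow_small (r e : R) : 0 <= r < 1 -> 0 < e -> exists n0, forall n, (n0 <= n)%N -> r ^+ n < e.
Proof.
move=> /andP[r0 r1] e0; have cv : r ^+ n @[n --> \oo] --> (0 : R).
  by apply: cvg_expr; rewrite ger0_norm.
have /cvgrPdist_lt/(_ e e0)[n0 _ h] := cv.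
by exists n0 => n /h/=; rewrite sub0r normrN ger0_norm ?exprn_ge0.
Qed.

Lemma hp_small (e : R) : 0 < e -> exists n0, forall n, (n0 <= n)%N -> hp n < e.
Proof. by apply: pow_small; rewrite invr_ge0 ler0n /= invf_lt1 ?ltr1n. Qed.

Lemma uniform_bound (m : nat) (P : nat -> nat -> Prop) :
  (forall k, (k < m)%N -> exists n0, forall n, (n0 <= n)%N -> P k n) ->
  exists n0, forall k n, (k < m)%N -> (n0 <= n)%N -> P k n.
Proof.
elim: m => [|m IH] h; first by exists 0%N.
have [n1 h1] := IH (fun k km => h k (ltnW km)).
have [n2 h2] := h m (ltnSn m).
exists (maxn n1 n2) => k n; rewrite ltnS leq_eqVlt geq_max => + /andP[a b].
by move=> /orP[/eqP->|km]; [exact: h2|exact: h1].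
Qed.

Lemma uniform_radius (m : nat) (P : nat -> R -> Prop) :
  (forall k, (k < m)%N -> exists2 d : R, 0 < d & P k d) ->
  (forall k d d', d' <= d -> P k d -> P k d') ->
  exists2 d : R, 0 < d & forall k, (k < m)%N -> P k d.
Proof.
move=> + mono; elim: m => [|m IH] h; first by exists 1.
have [d1 d10 h1] := IH (fun k km => h k (ltnW km)).
have [d2 d20 h2] := h m (ltnSn m).
exists (Num.min d1 d2); first by rewrite lt_min d10.
move=> k; rewrite ltnS leq_eqVlt => /orP[/eqP->|km].
  by apply: mono h2; rewrite ge_min lexx orbT.
by apply: mono (h1 _ km); rewrite ge_min lexx.
Qed.

End HalfPowers.
Arguments hp {R} m.

Section SweepingFunction.
Context {R : realType}.
Local Notation C := R[i].
Local Notation N := (@modc R).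

Lemma cvgc_le (u : nat -> C) l a (b : R) : cvgc u l ->
  (exists n0, forall n, (n0 <= n)%N -> N (u n - a) <= b) -> N (l - a) <= b.
Proof.
move=> ul [n0 h]; apply/ler_addgt0Pr => e e0.
have [n1 h1] := ul e e0; pose n := maxn n0 n1.
have := h n (leq_maxl _ _); have := h1 n (leq_maxr _ _); rewrite modc_distC.
have := modc_dist_triangle (u n) l a; lra.
Qed.

Lemma poly_lipschitz (p : {poly C}) : exists2 M : R, 0 < M & forall w v,
  N w <= 1 -> N v <= 1 -> N p.[v] <= M /\ N (p.[w] - p.[v]) <= M * N (w - v).
Proof.
elim/poly_ind: p => [|p c [M M0 h]].
  exists 1 => // w v _ _; rewrite !horner0 subrr !modc0 mul1r; split => //.
  exact: modc_ge0.
exists (2 * M + N c); first by have := modc_ge0 c; lra.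
move=> w v w1 v1; rewrite !hornerE; have [h1 h2] := h _ _ w1 v1.
have c0 := modc_ge0 c; have p0 := modc_ge0 p.[v]; have v0 := modc_ge0 v.
split.
  apply: le_trans (modc_triangle _ _) _; rewrite modcM lerD2r.
  apply: le_trans (_ : M * 1 <= _); last by lra.
  exact: ler_pM.
rewrite (_ : _ - _ = (p.[w] - p.[v]) * w + p.[v] * (w - v)); last by ring.
apply: le_trans (modc_triangle _ _) _; rewrite !modcM.
have d0 := modc_ge0 (w - v).
apply: le_trans (_ : M * N (w - v) * 1 + M * N (w - v) <= _).
  apply: lerD; last exact: ler_wpM2r.
  by apply: ler_pM => //; exact: modc_ge0.
have : 0 <= N c * N (w - v) by exact: mulr_ge0.
nra.
Qed.

Definition unit_interval : set C := [set w | complex.Im w = 0 /\ 0 <= complex.Re w <= 1].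

(* [Phi] is the sum of [(S m.+1 - S m) w^(n_m)]. The exponents grow so fast that on the m-th annulus around [1] the powers before the m-th are close to [1] and those after it close to [0], so [Phi] stays within [o(1)] of [S m] there; each [Q k] meets infinitely many annuli. Taking only partial sums with [S] close to [0] yields convergence at [1] as well. *)
Lemma sweeping_function (L : set C) (Q : nat -> set C) :
  L 1 ->
  (forall d : R, 0 < d -> exists2 r : R, 0 <= r < 1 &
     forall w, L w -> d <= N (1 - w) -> N w <= r) ->
  (forall k, Q k `<=` L `\ 1) ->
  exists (p : nat -> {poly C}) (Phi : C -> C), [/\ Phi 1 = 0,
    (forall k w, L w -> N (p k).[w] <= 5),
    (forall w, L w -> cvgc (fun k => (p k).[w]) (Phi w)),
    (forall w (e : R), L w -> w != 1 -> 0 < e -> exists2 d : R, 0 < d &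
       forall w', L w' -> N (w' - w) < d -> N (Phi w' - Phi w) < e) /\
    (forall e : R, 0 < e -> exists2 d : R, 0 < d & forall w, L w -> w != 1 ->
       N (1 - w) < d -> exists2 s, unit_interval s & N (Phi w - s) < e)
    & (forall k, (forall d : R, 0 < d -> exists2 w, Q k w & N (1 - w) < d) ->
       forall (s : C) (e d : R), unit_interval s -> 0 < e -> 0 < d ->
         exists w, [/\ Q k w, N (1 - w) < d & N (Phi w - s) < e])].
Proof.
move=> L1 LU QL.
have [S [S0 S01 Sstep Ssweep]] := @sweeping_sequence R.
have Lle w : L w -> N w <= 1.
  move=> Lw; have [->|w1] := eqVneq w 1; first by rewrite modc1.
  have [|r /andP[_ r1] h] := LU (N (1 - w)).
    by rewrite modc_gt0 subr_eq0 eq_sym.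
  by apply: le_trans (ltW r1); exact: h.
pose act k := forall d : R, 0 < d -> exists2 w, Q k w & N (1 - w) < d.
pose eps m : R := S m.+1 - S m.
have eps1 m : `|eps m| <= 1.
  by rewrite ler_norml /eps; have := S01 m; have := S01 m.+1; lra.
(* A state is a partial sum with a radius around 1 inside which it is within [hp m] of its value
   [S m] at 1. The transition [K] adds one term that is negligible outside the old radius. For each
   [Q k] with [k < m] that accumulates at 1, the annulus between the new and old radius contains a
   point of [Q k] where that term is negligible too. *)
pose J m (x : {poly C} * R) := [/\ m = 0%N -> x.2 = 3, 0 < x.2, x.1.[1] = (S m)%:C%C &
   forall w, L w -> N (1 - w) < x.2 -> N (x.1.[w] - (S m)%:C%C) < hp m].
pose K m (x y : {poly C} * R) := exists n : nat,
  [/\ y.1 = x.1 + ((eps m)%:C%C)%:P * 'X^n, y.2 <= x.2, y.2 <= hp m,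
    (forall w, L w -> x.2 <= N (1 - w) -> N w ^+ n <= hp m) &
    forall k, (k < m)%N -> act k -> exists y',
      [/\ Q k y', N (1 - y') < x.2, y.2 <= N (1 - y') & N y' ^+ n <= hp m]].
have [||f fP] := @dependent_choice_rel _ J K.
(* [L] lies in the closed unit disc, so 3 exceeds every distance to 1 and each point of [L] other
   than 1 falls into some annulus. *)
- exists (0, 3); split => //=; rewrite ?horner0 ?S0//.
  by move=> w Lw _; rewrite horner0 subrr modc0 hp_gt0.
- move=> m [p d] [/= _ d0 p1 pd].
  have /choice[y yP] (k : nat) : exists y, act k -> Q k y /\ N (1 - y) < d.
    by case: (pselect (act k)) => [/(_ d d0)[z ? ?]|?]; [exists z|exists 0].
  have ylt k : act k -> 0 < N (1 - y k).
    move=> /yP[/QL[_ /= y1] _]; rewrite modc_gt0 subr_eq0 eq_sym.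
    exact/eqP.
  have [r r01 rP] := LU d d0.
  have [n1 h1] := pow_small r01 (hp_gt0 m).
  have [n2 h2] : exists n0, forall k n, (k < m)%N -> (n0 <= n)%N ->
      act k -> N (y k) ^+ n <= hp m.
    apply: uniform_bound => k km; case: (pselect (act k)) => ak; last by exists 0%N.
    have [r' r'01 r'P] := LU _ (ylt _ ak).
    have [n0 h0] := pow_small r'01 (hp_gt0 m).
    exists n0 => n /h0 h _; apply: le_trans (ltW h); apply: lerXn2r.
    - by rewrite nnegrE modc_ge0.
    - by case/andP: r'01.
    - by apply: r'P => //; have [/QL[]] := yP _ ak.
  pose n := maxn n1 n2; pose p' := p + ((eps m)%:C%C)%:P * 'X^n.
  have [M M0 MP] := poly_lipschitz p'.
  have p'1 : p'.[1] = (S m.+1)%:C%C.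
    by rewrite /p' !hornerE p1 expr1n mulr1 -rmorphD/=; congr (_%:C%C); rewrite /eps; ring.
  have [d1 d10 hd1] : exists2 d1, 0 < d1 & forall k, (k < m)%N -> act k -> d1 <= N (1 - y k).
    apply: uniform_radius => [k km|k e e' ee' h a]; last by apply: le_trans ee' (h a).
    by case: (pselect (act k)) => ak; [exists (N (1 - y k)) => //; exact: ylt|exists 1].
  (* The bounds [d] and [hp m] make the radii decrease to 0, [d1] leaves the chosen points of the
     [Q k] outside the new radius, and [hp m.+1 / M], with [M] a Lipschitz constant of [p'], yields
     the estimate in [J m.+1]. *)
  pose d' := Num.min (Num.min d (hp m)) (Num.min d1 (hp m.+1 / M)).
  exists (p', d'); split.
    exists n; split => //=.
    + by rewrite /d' !ge_min lexx.
    + by rewrite /d' !ge_min lexx !orbT.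
    + move=> w Lw dw; apply: le_trans (ltW (h1 n (leq_maxl _ _))).
      apply: lerXn2r; rewrite ?nnegrE ?modc_ge0//; first by case/andP: r01.
      exact: rP.
    + move=> k km ak; exists (y k); have [? ?] := yP _ ak; split => //.
        by apply: le_trans (hd1 _ km ak); rewrite /d' !ge_min lexx !orbT.
      by apply: h2 => //; exact: leq_maxr.
  split => //=.
    by rewrite /d' !lt_min d0 !hp_gt0 d10 divr_gt0// hp_gt0.
  move=> w Lw; rewrite !lt_min => /andP[_ /andP[_]].
  rewrite ltr_pdivlMr// => wd.
  have [_ ] := MP w 1 (Lle _ Lw) ltac:(by rewrite modc1).
  rewrite p'1 => /le_lt_trans; apply; by rewrite mulrC modc_distC.
pose P m := (f m).1; pose d m := (f m).2.
have d_gt0 m : 0 < d m by have [[? ? ? ?] ?] := fP m.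
have P1 m : (P m).[1] = (S m)%:C%C by have [[? ? ? ?] ?] := fP m.
have Pd m w : L w -> N (1 - w) < d m -> N ((P m).[w] - (S m)%:C%C) < hp m.
  by have [[_ _ _ h] _] := fP m; exact: h.
have dS m : d m.+1 <= d m by have [_ [n []]] := fP m.
have dhp m : d m.+1 <= hp m by have [_ [n []]] := fP m.
have dmono m k : (m <= k)%N -> d k <= d m.
  by move=> /subnK <-; elim: (k - m)%N => // j IH; apply: le_trans IH; rewrite addSn.
have dsmall e : 0 < e -> exists n0, forall n, (n0 <= n)%N -> d n < e.
  move=> /hp_small[n0 h]; exists n0.+1 => -[//|n] n0n.
  exact: le_lt_trans (dhp n) (h _ n0n).
have Neps m : N (eps m)%:C%C <= 1 by rewrite modc_real.
have Pstep m w : L w -> N ((P m.+1).[w] - (P m).[w]) <= `|eps m|.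
  rewrite /P; have [_ [n [-> _ _ _ _]]] := fP m; move=> Lw.
  rewrite !hornerE addrAC subrr add0r modcM modc_real.
  rewrite ler_piMr// modcX; apply: exprn_ile1; [exact: modc_ge0|exact: Lle].
have Pfar m w : L w -> d m <= N (1 - w) -> N ((P m.+1).[w] - (P m).[w]) <= hp m.
  rewrite /P; have [_ [n [-> _ _ h _]]] := fP m; move=> Lw dw.
  rewrite !hornerE addrAC subrr add0r modcM modc_real modcX.
  have := h w Lw dw; have := eps1 m; have : 0 <= N w ^+ n by rewrite exprn_ge0// modc_ge0.
  have := normr_ge0 (eps m); nra.
have Ptail m k w : L w -> d m <= N (1 - w) -> (m <= k)%N ->
    N ((P k).[w] - (P m).[w]) <= 2 * hp m.
  move=> Lw dw /subnK <-.
  suff: N ((P (k - m + m)%N).[w] - (P m).[w]) <= 2 * hp m - 2 * hp (k - m + m)%N.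
    by have := @hp_gt0 R (k - m + m)%N; lra.
  elim: (k - m)%N => [|j IH]; first by rewrite add0n !subrr modc0.
  rewrite addSn; apply: le_trans (modc_dist_triangle (P (j + m)%N).[w] _ _) _.
  have := Pfar (j + m)%N w Lw (le_trans (dmono _ _ (leq_addl _ _)) dw).
  by have := @hpS R (j + m)%N; lra.
have Phi_ex w : exists l, L w -> w != 1 -> cvgc (fun m => (P m).[w]) l.
  case: (pselect (L w)) => Lw; last by exists 0.
  have [->|w1] := eqVneq w 1; first by exists 0.
  have w0 : 0 < N (1 - w) by rewrite modc_gt0 subr_eq0 eq_sym.
  have [m hm] := dsmall _ w0.
  have [||l [hl _]] := @cauchy_cvgc _ (fun n => (P (n + m)%N).[w]) (fun n => 2 * hp (n + m)%N).
  - move=> e e0; have [n h] := @hp_small R (e / 2) ltac:(lra).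
    by exists n; have := h _ (leq_addr m n); lra.
  - move=> n k nk; apply: Ptail => //; last by rewrite leq_add2r.
    by apply/ltW/hm; exact: leq_addl.
  exists l => _ _ e e0; have [n0 h] := hl e e0; exists (n0 + m)%N => n hn.
  have mn : (m <= n)%N by apply: leq_trans hn; exact: leq_addl.
  by have := h (n - m)%N; rewrite subnK//; apply; rewrite leq_subRL// addnC.
have [Psi PsiP] := choice Phi_ex.
pose Phi w := if w == 1 then 0 else Psi w.
have Phicv w : L w -> w != 1 -> cvgc (fun m => (P m).[w]) (Phi w).
  by move=> Lw w1; rewrite /Phi (negbTE w1); exact: PsiP.
have Phitail m w : L w -> w != 1 -> d m <= N (1 - w) -> N (Phi w - (P m).[w]) <= 2 * hp m.
  move=> Lw w1 dw; apply: cvgc_le (Phicv _ Lw w1) _; exists m => n mn.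
  exact: Ptail.
have annulus w : L w -> w != 1 -> exists2 m, d m.+1 <= N (1 - w) & N (1 - w) < d m.
  move=> Lw w1; have w0 : 0 < N (1 - w) by rewrite modc_gt0 subr_eq0 eq_sym.
  have ex : exists m, d m <= N (1 - w).
    by have [m h] := dsmall _ w0; exists m; exact/ltW/h.
  case: (ex_minnP ex) => -[|m] hm hmin.
    suff : N (1 - w) < d 0%N by rewrite ltNge hm.
    have := modc_triangle 1 (- w); rewrite modcN modc1.
    have d03 : d 0%N = 3 by rewrite /d; have [[-> //]] := fP 0%N.
    rewrite d03; have := Lle _ Lw; lra.
  exists m => //; rewrite ltNge; apply/negP => /hmin; by rewrite ltnn.
have Phiann m w : L w -> w != 1 -> d m.+1 <= N (1 - w) -> N (1 - w) < d m ->
    N (Phi w - (S m)%:C%C) <= `|eps m| + 2 * hp m.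
  move=> Lw w1 h1 h2; have := Pd m w Lw h2; have := Phitail _ _ Lw w1 h1.
  have := Pstep m w Lw; have := @hpS R m.
  have := modc_dist_triangle (P m.+1).[w] (Phi w) (S m)%:C%C.
  have := modc_dist_triangle (P m).[w] (P m.+1).[w] (S m)%:C%C.
  lra.
have SI m : unit_interval (S m)%:C%C by split => //; exact: S01.
have /choice[mk mkP] (k : nat) : exists m, (k <= m)%N /\ S m < hp k.
  have [|m km h] := Ssweep 0 (hp k) k _ (hp_gt0 k); first by rewrite lexx ler01.
  by exists m; split => //; move: h; rewrite subr0 ger0_norm//; case/andP: (S01 m).
have NS m : N (S m)%:C%C <= 1.
  by rewrite modc_real ger0_norm; case/andP: (S01 m).
exists (fun k => P (mk k)), Phi; split.
- by rewrite /Phi eqxx.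
(* Up to the annulus of [w] the partial sums are bounded by 2; the term of that annulus adds at most
   1 and the tail at most 1, so 5 leaves room. *)
- move=> k w Lw; move: (mk k) => m.
  have [->|w1] := eqVneq w 1; first by rewrite P1; have := NS m; lra.
  have [mu h1 h2] := annulus _ Lw w1.
  have near j : N (1 - w) < d j -> N (P j).[w] <= 2.
    move=> /(Pd j w Lw) h; have := NS j; have := @hp_le1 R j.
    by have := modc_lerB_dist (P j).[w] (S j)%:C%C; lra.
  have [mmu|mum] := leqP m mu.
    by have := near m (lt_le_trans h2 (dmono _ _ mmu)); lra.
  have := Ptail _ _ _ Lw h1 mum; have := near _ h2; have := Pstep mu _ Lw.
  have := eps1 mu; have := @hp_le1 R mu; have := @hpS R mu.
  have := modc_lerB_dist (P m).[w] (P mu.+1).[w].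
  have := modc_lerB_dist (P mu.+1).[w] (P mu).[w]; lra.
- move=> w Lw e e0; have [->|w1] := eqVneq w 1.
    have [n0 h] := hp_small e0; exists n0 => n nn0.
    rewrite /Phi eqxx subr0 P1 modc_real ger0_norm; last by case/andP: (S01 (mk n)).
    by have [_ h2] := mkP n; apply: lt_trans h2 (h _ nn0).
  have [n0 h] := Phicv _ Lw w1 e e0; exists n0 => n nn0.
  by apply: h; apply: leq_trans nn0 _; have [] := mkP n.
- split.
    move=> w e Lw w1 e0; have w0 : 0 < N (1 - w) by rewrite modc_gt0 subr_eq0 eq_sym.
    have [n1 h1] := @hp_small R (e / 6) ltac:(lra).
    have [n2 h2] := dsmall (N (1 - w) / 2) ltac:(lra).
    pose m := maxn n1 n2.
    have [M M0 MP] := poly_lipschitz (P m).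
    exists (Num.min (N (1 - w) / 2) (e / 3 / M)).
      by rewrite lt_min !divr_gt0.
    move=> w' Lw'; rewrite lt_min (ltr_pdivlMr _ _ M0) => /andP[c1 c2].
    have tri := modc_dist_triangle w' 1 w.
    have dm := h2 m (leq_maxr _ _).
    have w'1 : w' != 1.
      by apply: contraTneq c1 => ->; rewrite -leNgt; lra.
    have a1 := Phitail m w Lw w1 ltac:(lra).
    have a2 := Phitail m w' Lw' w'1 ltac:(lra).
    have [_ a3] := MP w' w (Lle _ Lw') (Lle _ Lw).
    have := h1 m (leq_maxl _ _).
    have := modc_dist_triangle (P m).[w'] (Phi w') (Phi w).
    have := modc_dist_triangle (P m).[w] (P m).[w'] (Phi w).
    rewrite (modc_distC (P m).[w]) => b1 b2 b3.
    have c2' : M * N (w' - w) < e / 3 by rewrite [M * _]mulrC.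
    lra.
  move=> e e0; have [n1 h1] := @hp_small R (e / 4) ltac:(lra).
  have [n2 h2] := Sstep (e / 2) ltac:(lra).
  pose M := maxn n1 n2; exists (d M) => // w Lw w1 wd.
  have [m c1 c2] := annulus _ Lw w1.
  have Mm : (M <= m)%N.
    rewrite leqNgt; apply/negP => /dmono h; have := le_trans h c1.
    by rewrite leNgt wd.
  exists (S m)%:C%C => //; have := Phiann _ _ Lw w1 c1 c2.
  have := h1 m (leq_trans (leq_maxl _ _) Mm).
  have := h2 m (leq_trans (leq_maxr _ _) Mm); rewrite -/(eps m); lra.
move=> k ak s e dl [sI s01] e0 dl0.
have [n1 h1] := @hp_small R (e / 6) ltac:(lra).
have [n2 h2] := dsmall dl dl0.
(* Having [m > k] guarantees that step [m] has a point of [Q k] in its annulus; there [Phi] is close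
   to [S m], which is close to [s]. *)
have [m Mm hm] := Ssweep (complex.Re s) (e / 2) (maxn k.+1 (maxn n1 n2)) s01 ltac:(lra).
move: Mm; rewrite !geq_max => /and3P[km n1m n2m].
have [_ [n [Pn _ _ _ /(_ k km ak)[y [Qy y1 y2 yn]]]]] := fP m.
have [Ly /eqP y1'] := QL _ _ Qy.
exists y; split => //; first by apply: lt_trans y1 (h2 _ n2m).
have b1 := Phitail m.+1 y Ly y1' y2.
have b2 := Pd m y Ly y1.
have b3 : N ((P m.+1).[y] - (P m).[y]) <= hp m.
  rewrite /P Pn !hornerE addrAC subrr add0r modcM modc_real modcX.
  have := eps1 m; have : 0 <= N y ^+ n by rewrite exprn_ge0// modc_ge0.
  have := normr_ge0 (eps m); nra.
have b4 : N ((S m)%:C%C - s) < e / 2.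
  rewrite (_ : s = (complex.Re s)%:C%C); last by case: (s) sI => a b /= ->.
  by rewrite -rmorphB modc_real.
have := h1 m n1m; have := @hpS R m.
have := modc_dist_triangle (P m.+1).[y] (Phi y) s.
have := modc_dist_triangle (P m).[y] (P m.+1).[y] s.
have := modc_dist_triangle (S m)%:C%C (P m).[y] s.
lra.
Qed.

End SweepingFunction.

(** * Bounded limits of polynomials on the circle *)

Section HInfinity.
Context {R : realType}.
Local Notation C := R[i].
Local Notation N := (@modc R).
Local Notation Re := (@complex.Re R).
Local Notation Im := (@complex.Im R).
Implicit Types (t : R) (p q : {poly C}).

Definition circ t : C := (cos t +i* sin t)%C.

Lemma modc_circ t : N (circ t) = 1.
Proof. by rewrite /modc/= cos2Dsin2 sqrtr1. Qed.

Lemma ReM (x y : C) : Re (x * y) = Re x * Re y - Im x * Im y.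
Proof. by case: x y => a b [c d]. Qed.

Lemma ImM (x y : C) : Im (x * y) = Re x * Im y + Im x * Re y.
Proof. by case: x y => a b [c d]. Qed.

(* Plays the role of the bounded analytic functions of the disc. Limits are required to hold at every point, so that no null sets occur. *)
Inductive bounded_limit_closure : (R -> C) -> Prop :=
| BLC_poly p : bounded_limit_closure (fun t => p.[circ t])
| BLC_lim (u : nat -> R -> C) (phi : R -> C) (M : R) :
    (forall n, bounded_limit_closure (u n)) ->
    (forall n t, N (u n t) <= M) ->
    (forall t, cvgc (fun n => u n t) (phi t)) ->
    bounded_limit_closure phi.

Local Notation HH := bounded_limit_closure.

Lemma BLC_const (c : C) : HH (fun=> c).
Proof.
rewrite (_ : (fun=> c) = fun t => (c%:P).[circ t]); first exact: BLC_poly.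
by apply/funext => t; rewrite hornerC.
Qed.

Lemma BLC_circ : HH circ.
Proof.
rewrite (_ : circ = fun t => 'X.[circ t]); first exact: BLC_poly.
by apply/funext => t; rewrite hornerX.
Qed.

Lemma BLC_bounded f : HH f -> exists M : R, forall t, N (f t) <= M.
Proof.
elim=> [p|u phi M _ _ uM cv].
  have [M _ h] := poly_lipschitz p; exists M => t.
  by have [] := h (circ t) (circ t) ltac:(by rewrite modc_circ) ltac:(by rewrite modc_circ).
exists M => t; rewrite -[phi t]subr0; apply: cvgc_le (cv t) _; exists 0%N => n _.
by rewrite subr0.
Qed.

(** The two derivations are unfolded one after the other; [BLC_bounded] bounds the argument held
    fixed. *)
Lemma BLC_add f g : HH f -> HH g -> HH (fun t => f t + g t).
Proof.
move=> + Hg; elim=> [p|u phi M Hu IH uM cv].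
  elim: Hg => [q|u phi M Hu IH uM cv].
    rewrite (_ : (fun t => _) = fun t => (p + q).[circ t]); first exact: BLC_poly.
    by apply/funext => t; rewrite hornerD.
  have [K KP] := BLC_bounded (BLC_poly p).
  apply: (@BLC_lim (fun n t => p.[circ t] + u n t) _ (K + M)) => //.
    by move=> n t; apply: le_trans (modc_triangle _ _) _; exact: lerD.
  by move=> t; apply: cvgcD (cv t); exact: cvgc_const.
have [K KP] := BLC_bounded Hg.
apply: (@BLC_lim (fun n t => u n t + g t) _ (M + K)) => //.
  by move=> n t; apply: le_trans (modc_triangle _ _) _; exact: lerD.
by move=> t; apply: cvgcD (cv t) _; exact: cvgc_const.
Qed.

Lemma BLC_mul f g : HH f -> HH g -> HH (fun t => f t * g t).
Proof.
move=> + Hg; elim=> [p|u phi M Hu IH uM cv].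
  elim: Hg => [q|u phi M Hu IH uM cv].
    rewrite (_ : (fun t => _) = fun t => (p * q).[circ t]); first exact: BLC_poly.
    by apply/funext => t; rewrite hornerM.
  have [K KP] := BLC_bounded (BLC_poly p).
  apply: (@BLC_lim (fun n t => p.[circ t] * u n t) _ (K * M)) => //.
    by move=> n t; rewrite modcM; apply: ler_pM => //; exact: modc_ge0.
  by move=> t; apply: cvgcMl (cv t).
have [K KP] := BLC_bounded Hg.
apply: (@BLC_lim (fun n t => u n t * g t) _ (M * K)) => //.
  by move=> n t; rewrite modcM; apply: ler_pM => //; exact: modc_ge0.
move=> t; rewrite mulrC (_ : (fun n => _) = fun n => g t * u n t); last first.
  by apply/funext => n; rewrite mulrC.
exact: cvgcMl.
Qed.

Lemma is_derive_circ_poly q t :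
  is_derive t 1 (fun s : R => Re q.[circ s]) (Re ('i%C * circ t * q^`().[circ t])) /\
  is_derive t 1 (fun s : R => Im q.[circ s]) (Im ('i%C * circ t * q^`().[circ t])).
Proof.
elim/poly_ind: q => [|q c [IHr IHi]].
  rewrite deriv0; split.
    rewrite (_ : (fun s => _) = cst 0); last by apply/funext => s; rewrite horner0.
    by rewrite horner0 mulr0; exact: is_derive_cst.
  rewrite (_ : (fun s => _) = cst 0); last by apply/funext => s; rewrite horner0.
  by rewrite horner0 mulr0; exact: is_derive_cst.
set r := fun s : R => Re q.[circ s]; set i := fun s : R => Im q.[circ s].
have dr : is_derive t 1 r (Re ('i%C * circ t * q^`().[circ t])) by [].
have di : is_derive t 1 i (Im ('i%C * circ t * q^`().[circ t])) by [].
have dc := is_derive_cos t; have ds := is_derive_sin t.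
split.
  rewrite (_ : (fun s => _) = r * cos - i * sin + cst (Re c)); last first.
    by apply/funext => s; rewrite !hornerE raddfD/= ReM.
  apply: is_derive_eq; rewrite derivD derivM derivX derivC !hornerE/= /GRing.scale/=.
  rewrite !ReM !ImM /r /i !raddfD/= !ReM !ImM/=; ring.
rewrite (_ : (fun s => _) = r * sin + i * cos + cst (Im c)); last first.
  by apply/funext => s; rewrite !hornerE raddfD/= ImM.
apply: is_derive_eq; rewrite derivD derivM derivX derivC !hornerE/= /GRing.scale/=.
rewrite !ReM !ImM /r /i !raddfD/= !ReM !ImM/=; ring.
Qed.

Lemma poly_primitive p : exists q, q^`() = p.
Proof.
exists (\poly_(i < (size p).+1) (p`_i.-1 / i%:R)).
apply/polyP => i; rewrite coef_deriv coef_poly ltnS.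
case: ltnP => [_|sp]; last by rewrite mul0rn nth_default.
by rewrite /= -(mulr_natr (p`_i / _)) mulfVK// pnatr_eq0.
Qed.

Lemma measurable_Re_Im_circ_poly p :
  measurable_fun setT (fun t : R => Re p.[circ t]) /\
  measurable_fun setT (fun t : R => Im p.[circ t]).
Proof.
have h (f : R -> R) : (forall t, exists a, is_derive t 1 f a) -> measurable_fun setT f.
  move=> df; apply: measurable_realfun.continuous_measurable_fun => t; have [a da] := df t.
  by apply: differentiable_continuous; apply/derivable1_diffP.
by split; apply: h => t; have [? ?] := is_derive_circ_poly p t; eexists; eassumption.
Qed.

Lemma cvgc_Re u (l : C) : cvgc u l -> Re (u n) @[n --> \oo] --> Re l.
Proof.
move=> cv; apply/cvgrPdist_lt => e e0; have [n0 h] := cv e e0; exists n0 => // n /h.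
by rewrite /= distrC -raddfB; apply: le_lt_trans; exact: normr_Re_le.
Qed.

Lemma cvgc_Im u (l : C) : cvgc u l -> Im (u n) @[n --> \oo] --> Im l.
Proof.
move=> cv; apply/cvgrPdist_lt => e e0; have [n0 h] := cv e e0; exists n0 => // n /h.
by rewrite /= distrC -raddfB; apply: le_lt_trans; exact: normr_Im_le.
Qed.

Lemma BLC_measurable f : HH f ->
  measurable_fun setT (Re \o f) /\ measurable_fun setT (Im \o f).
Proof.
elim=> [p|u phi M _ IH _ cv]; first exact: measurable_Re_Im_circ_poly.
split.
  apply: (@measurable_fun_cvg _ _ _ _ (fun n => Re \o u n)) => [n|t _].
    by have [] := IH n.
  exact: cvgc_Re.
apply: (@measurable_fun_cvg _ _ _ _ (fun n => Im \o u n)) => [n|t _].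
  by have [] := IH n.
exact: cvgc_Im.
Qed.

Local Notation mu := (@lebesgue_measure R).
Local Notation I := (`[0, 2 * pi]%classic : set R).

Lemma pi2_gt0 : 0 < 2 * pi :> R.
Proof. by have := pi_gt0 R; lra. Qed.

Lemma circ2pi : circ (2 * pi) = circ 0.
Proof. by rewrite /circ -[2 * pi]add0r mulrC mulr_natr cosD2pi sinD2pi. Qed.

(** The derivative of q(circ t) is i circ t q'(circ t), so a primitive [q] of -i p turns the
    integrand into the derivative of a function with equal values at 0 and 2 pi. *)
Lemma integral_circ_poly p : (\int[mu]_(t in I) (Re (circ t * p.[circ t]))%:E = 0)%E.
Proof.
have [q qp] := poly_primitive (- 'i%C *: p).
have dq t : is_derive t 1 (fun s : R => Re q.[circ s]) (Re (circ t * p.[circ t])).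
  have [+ _] := is_derive_circ_poly q t; rewrite qp hornerZ.
  rewrite (_ : _ * _ * _ = circ t * p.[circ t])//.
  rewrite (_ : _ * _ = - ('i%C * 'i%C) * (circ t * p.[circ t])); last by ring.
  by rewrite -expr2 sqr_i opprK mul1r.
have cq : continuous (fun s : R => Re q.[circ s]).
  move=> t; apply: differentiable_continuous; apply/derivable1_diffP.
  by have [] := dq t.
rewrite (@continuous_FTC2 R _ (fun s : R => Re q.[circ s])).
- by rewrite circ2pi subee.
- exact: pi2_gt0.
- apply: continuous_subspaceT => t.
  rewrite (_ : (fun t => _) = fun t : R => Re (('X * p).[circ t])); last first.
    by apply/funext => s; rewrite hornerM hornerX.
  apply: differentiable_continuous; apply/derivable1_diffP.
  by have [[]] := is_derive_circ_poly ('X * p) t.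
- split.
  + by move=> t _; have [] := dq t.
  + by apply: cvg_at_right_filter; exact: cq.
  + by apply: cvg_at_left_filter; exact: cq.
- by move=> t _; rewrite derive1E; have [] := dq t.
Qed.

Lemma BLC_orthogonal f : HH f -> (\int[mu]_(t in I) (Re (circ t * f t))%:E = 0)%E.
Proof.
elim=> [p|u phi M Hu IH uM cv]; first exact: integral_circ_poly.
have Hphi : HH phi by apply: BLC_lim Hu uM cv.
have meas g : HH g -> measurable_fun I (fun t => (Re (circ t * g t))%:E).
  move=> Hg; apply/measurable_EFinP; apply: measurable_funS (@measurableT _ R) _ _ => //.
  by have [] := BLC_measurable (BLC_mul BLC_circ Hg).
have mI : measurable I by exact: measurable_itv.
have ig : mu.-integrable I (fun=> M%:E).
  apply/integrableP; split; first exact: measurable_cst.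
  rewrite integral_cst//= lebesgue_measure_itv/= lte_fin pi2_gt0.
  by rewrite -EFinD -EFinM ltry.
have lim_ae : {ae mu, forall t, I t ->
    (Re (circ t * u n t))%:E @[n --> \oo] --> (Re (circ t * phi t))%:E}.
  apply: aeW => t _; apply: cvg_EFin; first exact: nearW.
  by apply: cvgc_Re; apply: cvgcMl.
have dom_ae : {ae mu, forall t n, I t -> (`|(Re (circ t * u n t))%:E| <= M%:E)%E}.
  apply: aeW => t n _; rewrite lee_fin.
  by apply: le_trans (normr_Re_le _) _; rewrite modcM modc_circ mul1r.
have [_ _] := @dominated_convergence _ _ R mu I mI
  (fun n t => (Re (circ t * u n t))%:E) (fun t => (Re (circ t * phi t))%:E)
  (fun=> M%:E) (fun n => meas _ (Hu n)) (meas _ Hphi) lim_ae ig dom_ae.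
rewrite (_ : [sequence _]_n = cst 0%E); last by apply/funext => n /=; exact: IH.
by move=> /cvg_lim => <-//; rewrite lim_cst.
Qed.

(* The whole closure is orthogonal to [circ], whereas [circ] times its conjugate is [1]. *)
Lemma BLC_dist_conj f (r : R) : HH f -> r < 1 ->
  ~ forall t, N ((circ t)^*%C - f t) <= r.
Proof.
move=> Hf r1 H; have := BLC_orthogonal Hf; apply/eqP; rewrite gt_eqF//.
have low t : 1 - r <= Re (circ t * f t).
  have zz : circ t * (circ t)^*%C = 1 by rewrite -sqr_normc -add_Re2_Im2/= cos2Dsin2.
  have : N (circ t * ((circ t)^*%C - f t)) <= r by rewrite modcM modc_circ mul1r.
  rewrite mulrBr zz => /(le_trans (normr_Re_le _)); rewrite raddfB/= ler_norml.
  by move=> /andP[_]; lra.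
apply: (@lt_le_trans _ _ (\int[mu]_(t in I) (1 - r)%:E)%E).
  rewrite integral_cst//= lebesgue_measure_itv/= lte_fin pi2_gt0 -EFinD -EFinM lte_fin.
  by rewrite subr0 mulr_gt0 ?pi2_gt0// subr_gt0.
apply: ge0_le_integral => //.
- by move=> t _; rewrite lee_fin subr_ge0 ltW.
- apply/measurable_EFinP; apply: measurable_funS (@measurableT _ R) _ _ => //.
  by have [] := BLC_measurable (BLC_mul BLC_circ Hf).
- by move=> t _; rewrite lee_fin.
Qed.

End HInfinity.

(** * Functions on products of complex lines *)

Section ComplexTopology.
Context {R : realType}.
Local Notation C := R[i].
Local Notation N := (@modc R).

Lemma nbhs_modcP (z : R[i]^o) (A : set R[i]^o) :
  nbhs z A <-> exists2 e : R, 0 < e & forall w : C, N (w - z) < e -> A w.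
Proof.
split=> [/nbhs_ballP[e /= e0 eA]|[e e0 eA]].
  have [eR er] : exists er : R, e = er%:C%C.
    exists (complex.Re e); rewrite RRe_real//; exact: gtr0_real.
  move: e0; rewrite er ltcR => er0; exists eR => // w h; apply: eA.
  by rewrite /ball/= er ltcR -/(N (z - w)) modc_distC.
apply/nbhs_ballP; exists (e%:C%C); first by rewrite /= ltcR.
move=> w /= h; apply: eA; move: h.
by rewrite /ball/= ltcR -/(N (z - w)) modc_distC.
Qed.

Lemma compact_square (M : R) :
  compact ([set z | `|complex.Re z| <= M /\ `|complex.Im z| <= M] : set R[i]^o).
Proof.
pose f (x : R * R) : R[i]^o := (x.1 +i* x.2)%C.
have cf : continuous f.
  move=> x A /nbhs_modcP[e e0 eA].
  have e2 : 0 < e / 2 by lra.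
  exists (ball x.1 (e / 2), ball x.2 (e / 2)); first by split; exact: nbhsx_ballx.
  move=> [a b] [/= ha hb]; apply: eA; apply: le_lt_trans (modc_le_ReIm _) _.
  rewrite !raddfB/= [`|a - _|]distrC [`|b - _|]distrC.
  by move: ha hb; rewrite /ball/=; lra.
rewrite (_ : [set z | _] = f @` (`[- M, M]%classic `*` `[- M, M]%classic)).
  apply: continuous_compact; first exact: continuous_subspaceT.
  by apply: compact_setX; exact: segment_compact.
apply/seteqP; split=> [[a b] /= [ha hb]|_ [[a b] [/= ha hb] <-] /=].
  by exists (a, b) => //; split; rewrite /= in_itv/= -ler_norml.
by move: ha hb; rewrite !in_itv/= -!ler_norml.
Qed.

End ComplexTopology.

Section ProductTopology.
Context {R : realType} (I : choiceType).
Local Notation C := R[i].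
Local Notation N := (@modc R).
Local Notation P := (prod_topology (fun _ : I => R[i]^o : topologicalType)).

Lemma nbhs_coord (p : P) i (e : R) : 0 < e -> nbhs p [set q : P | N (q i - p i) < e].
Proof.
move=> e0; apply: (@proj_continuous I (fun=> R[i]^o : topologicalType) i p [set z | N (z - p i) < e]).
by apply/nbhs_modcP; exists e.
Qed.

(** The boxes around [p] generate a filter that converges to [p] in each coordinate, hence in the
    product topology, which is the supremum of the topologies induced by the coordinates. *)
Lemma nbhs_boxP (p : P) (U : set P) :
  nbhs p U <-> exists (s : seq I) (e : R), 0 < e /\
    forall q : P, (forall i, i \in s -> N (q i - p i) < e) -> U q.
Proof.
split; last first.
  move=> [s [e [e0 sU]]]; apply: filterS sU _.
  elim: s => [|i s IH]; first by apply: filterS filterT.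
  apply: filterS2 IH (nbhs_coord p i e0) => q h1 h2 j; rewrite inE => /orP[/eqP->//|].
  exact: h1.
pose B := filter_from [set se : seq I * R | 0 < se.2]
  (fun se => [set q : P | forall i, i \in se.1 -> N (q i - p i) < se.2]).
have FB : ProperFilter B.
  apply: filter_from_proper; last first.
    by move=> [s e] /= e0; exists p => i _; rewrite subrr modc0.
  apply: filter_from_filter; first by exists ([::], 1) => /=.
  move=> [s e] [s' e'] /= e0 e0'; exists (s ++ s', Num.min e e') => /=.
    by rewrite lt_min e0.
  move=> q h; split=> i si; have := h i; rewrite mem_cat si ?orbT lt_min => /(_ isT);
    by move=> /andP[].
have Bp : B --> p.
  apply/cvg_sup => i; move=> A [V [[Q oQ <-] /= Qp] QA].
  have /nbhs_modcP[e e0 eQ] : nbhs (p i : R[i]^o) Q by exact: open_nbhs_nbhs.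
  exists ([:: i], e) => //= q h; apply: QA; apply: eQ; apply: h; exact: mem_head.
move=> /Bp [[s e] /= e0 h]; by exists s, e.
Qed.

Lemma hausdorff_prod_complex : hausdorff_space P.
Proof.
move=> p q pq; apply/funext => i; apply/eqP; rewrite -subr_eq0 -modc_eq0.
rewrite eq_le modc_ge0 andbT; apply/ler_addgt0Pr => e e0; rewrite add0r.
have e2 : 0 < e / 2 by lra.
have [r [/= h1 h2]] := pq _ _ (nbhs_coord p i e2) (nbhs_coord q i e2).
have := modc_dist_triangle (r i) (p i) (q i); rewrite (modc_distC (p i) (r i)); lra.
Qed.

Lemma compact_box (M : R) : compact [set p : P | forall i, `|complex.Re (p i)| <= M /\ `|complex.Im (p i)| <= M].
Proof.
apply: (@tychonoff I (fun=> R[i]^o : topologicalType)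
  (fun=> [set z : C | `|complex.Re z| <= M /\ `|complex.Im z| <= M])) => _.
exact: compact_square.
Qed.

End ProductTopology.

Lemma nbhs_all (T : topologicalType) (x : T) (Q : set T) : (forall y, Q y) -> nbhs x Q.
Proof. by move=> h; apply: filterS filterT. Qed.

Section ContinuousOn.
Context {R : realType} {T : topologicalType}.
Local Notation C := R[i].
Local Notation N := (@modc R).
Implicit Types (K : set T) (f g : T -> C).

(** Only the values on [K] count: functions on a stage are given on the whole product and may be
    arbitrary off the stage. *)
Definition cont_on K f := forall p, K p -> forall e : R, 0 < e ->
  \forall q \near p, K q -> N (f q - f p) < e.

Lemma cont_on_cst K c : cont_on K (fun=> c).
Proof. by move=> p _ e e0; apply: nearW => q _; rewrite subrr modc0. Qed.

Lemma cont_onD K f g : cont_on K f -> cont_on K g -> cont_on K (fun x => f x + g x).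
Proof.
move=> cf cg p Kp e e0; have e2 : 0 < e / 2 by lra.
apply: filterS2 (cf p Kp _ e2) (cg p Kp _ e2) => q h1 h2 Kq.
rewrite (_ : _ - _ = (f q - f p) + (g q - g p)); last by ring.
by apply: le_lt_trans (modc_triangle _ _) _; have := h1 Kq; have := h2 Kq; lra.
Qed.

Lemma cont_onM K f g : cont_on K f -> cont_on K g -> cont_on K (fun x => f x * g x).
Proof.
move=> cf cg p Kp e e0; have f0 := modc_ge0 (f p); have g0 := modc_ge0 (g p).
pose M := N (f p) + N (g p) + 1.
have M0 : 0 < M by rewrite /M; lra.
pose d := Num.min 1 (e / M).
have d0 : 0 < d by rewrite lt_min ltr01 divr_gt0.
apply: filterS2 (cf p Kp _ d0) (cg p Kp _ d0) => q + + Kq => /(_ Kq) h1 /(_ Kq) h2.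
rewrite (_ : _ - _ = (f q - f p) * g p + (f p * (g q - g p) + (f q - f p) * (g q - g p))); last by ring.
apply: le_lt_trans (_ : d * N (g p) + (N (f p) * d + N (f q - f p) * 1) < _); last first.
  have : d * M <= e by rewrite -ler_pdivlMr// ge_min lexx orbT.
  rewrite /M; nra.
apply: le_trans (modc_triangle _ _) _; apply: lerD.
  by rewrite modcM ler_wpM2r// ltW.
apply: le_trans (modc_triangle _ _) _; apply: lerD; rewrite modcM.
  by rewrite ler_wpM2l// ltW.
rewrite ler_wpM2l ?modc_ge0// ltW//; apply: lt_le_trans h2 _.
by rewrite ge_min lexx.
Qed.

Lemma cont_on_uniform K (f_ : nat -> T -> C) f :
  (forall n, cont_on K (f_ n)) ->
  (forall e : R, 0 < e -> exists n, forall x, K x -> N (f x - f_ n x) <= e) -> cont_on K f.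
Proof.
move=> cf fu p Kp e e0; have e3 : 0 < e / 4 by lra.
have [n h] := fu _ e3; apply: filterS (cf n p Kp _ e3) => q + Kq => /(_ Kq) h1.
have := h p Kp; have := h q Kq.
have := modc_dist_triangle (f_ n q) (f q) (f p).
have := modc_dist_triangle (f_ n p) (f_ n q) (f p).
rewrite (modc_distC (f_ n p) (f p)); lra.
Qed.

Lemma cont_on_modc_lt K f p (c : R) : cont_on K f -> K p -> N (f p) < c ->
  \forall q \near p, K q -> N (f q) < c.
Proof.
move=> cf Kp fpc; have e0 : 0 < c - N (f p) by lra.
apply: filterS (cf p Kp _ e0) => q h /h; have := modc_lerB_dist (f q) (f p); lra.
Qed.

(** Compactness turns the strict pointwise inequality on the relatively closed part [c <= N (f y)]
    into a uniform one. With [f = 1 - h] this is the hypothesis on [L] in [sweeping_function]; it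
    also controls the exponents in [peaks_on_bishop]. *)
Lemma compact_strict_bound K f h (c : R) : compact K -> cont_on K f -> cont_on K h ->
  (forall y, K y -> c <= N (f y) -> N (h y) < 1) ->
  exists2 r : R, 0 <= r < 1 & forall y, K y -> c <= N (f y) -> N (h y) <= r.
Proof.
move=> /compact_near_coveringP cK cf ch fh.
have [|n _ hn] := cK nat \oo (fun n y => K y -> c <= N (f y) -> N (h y) <= 1 - hp n) _.
  move=> y Ky; have [fyc|cfy] := ltP (N (f y)) c.
    exists ([set y' | K y' -> N (f y') < c], setT); first by split; [exact: cont_on_modc_lt|exact: filterT].
    by move=> [y' n] [/= h1 _] /h1; rewrite ltNge => /negbTE ->.
  have hy := fh y Ky cfy.
  have [m hm] := @hp_small R ((1 - N (h y)) / 2) ltac:(lra).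
  have hy' : N (h y) < 1 - (1 - N (h y)) / 2 by lra.
  exists ([set y' | K y' -> N (h y') < 1 - (1 - N (h y)) / 2], [set n | (m <= n)%N]).
    by split; [exact: cont_on_modc_lt|exists m].
  by move=> [y' n] [/= h1 /hm mn] /h1; lra.
exists (1 - hp n); first by rewrite subr_ge0 hp_le1 gtrBl hp_gt0.
by move=> y Ky; apply: hn => //=.
Qed.

(** Being near the peak value forces being near the peak point, so points found by their value under
    [g] can be placed in a given neighbourhood of [x]. *)
Lemma compact_peak_nbhs K g x U : compact K -> cont_on K g ->
  (forall y, K y -> y <> x -> g y <> 1) -> nbhs x U ->
  exists2 e : R, 0 < e & forall y, K y -> N (1 - g y) < e -> U y.
Proof.
move=> /compact_near_coveringP cK cg gx Ux.
have [|n _ hn] := cK nat \oo (fun n y => K y -> N (1 - g y) < hp n -> U y) _.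
  move=> y Ky; have [->|yx] := pselect (y = x).
    exists (U, setT); first by split => //; exact: filterT.
    by move=> [y' n] [].
  have gy : 0 < N (1 - g y).
    rewrite modc_gt0 subr_eq0; apply/eqP => /esym; exact: gx.
  have [m hm] := @hp_small R (N (1 - g y) / 2) ltac:(lra).
  have g2 : 0 < N (1 - g y) / 2 by lra.
  exists ([set y' | K y' -> N (g y' - g y) < N (1 - g y) / 2], [set n | (m <= n)%N]).
    by split; [exact: cg|exists m].
  move=> [y' n] [/= h1 /hm mn] /h1 h2.
  by have := modc_dist_triangle (g y') 1 (g y); lra.
exists (hp n); first exact: hp_gt0.
by move=> y Ky; apply: hn => //=.
Qed.

Lemma compact_modc_bounded K f : compact K -> cont_on K f ->
  exists M : R, forall y, K y -> N (f y) <= M.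
Proof.
move=> /compact_near_coveringP cK cf.
have [|n _ hn] := cK nat \oo (fun n y => K y -> N (f y) <= n%:R) _.
  move=> y Ky; pose m := Num.bound (N (f y) + 1).
  have hm : N (f y) + 1 < m%:R by apply: archi_boundP; have := modc_ge0 (f y); lra.
  exists ([set y' | K y' -> N (f y') < m%:R], [set n | (m <= n)%N]).
    by split; [apply: cont_on_modc_lt => //; lra|exists m].
  move=> [y' n] [/= h1 mn] /h1 h2; apply/ltW/(lt_le_trans h2); by rewrite ler_nat.
by exists n%:R => y Ky; exact: (hn n (leqnn n)).
Qed.

End ContinuousOn.

(** * The inverse limit *)

Lemma unit_interval_closed {R : realType} (z : R[i]) :
  (forall e : R, 0 < e -> exists2 s, unit_interval s & modc (z - s) < e) ->
  unit_interval z.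
Proof.
move=> h; split.
  apply/eqP; rewrite -normr_eq0 eq_le normr_ge0 andbT; apply/ler_addgt0Pr => e e0.
  rewrite add0r; have [s [s0 _] zs] := h e e0.
  by have := le_lt_trans (normr_Im_le _) zs; rewrite raddfB/= s0 subr0 => /ltW.
apply/andP; split; apply/ler_addgt0Pr => e e0; have [s [_ /andP[s0 s1]] zs] := h e e0;
  have := le_lt_trans (normr_Re_le _) zs; rewrite raddfB/= ltr_norml => /andP[]; lra.
Qed.

Lemma unit_interval0 {R : realType} : unit_interval (0 : R[i]).
Proof. by split=> //=; rewrite lexx ler01. Qed.

Section Tower.
Context {R : realType} {d : Order.disp_t} {W : orderType d}.
Hypothesis HW : is_omega1 W.
Local Notation C := R[i].
Local Notation N := (@modc R).
Local Notation P := (prod_topology (fun _ : option W => R[i]^o : topologicalType)).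
Implicit Types (a b c : W) (p q x y : P).

(** Zeroing the coordinates instead of dropping them keeps all stages in one product space, so the
    bonding maps compose without any change of type. *)
Definition tr a p : P := fun i =>
  if i is Some b then (if (b < a)%O then p i else 0) else p None.

Lemma tr_None a p : tr a p None = p None. Proof. by []. Qed.

Lemma tr_lt a b p : (b < a)%O -> tr a p (Some b) = p (Some b).
Proof. by rewrite /tr => ->. Qed.

Lemma tr_ge a b p : (a <= b)%O -> tr a p (Some b) = 0.
Proof. by rewrite /tr leNgt => /negbTE ->. Qed.

Lemma tr_eq a p q : p None = q None ->
  (forall b, (b < a)%O -> p (Some b) = q (Some b)) -> tr a p = tr a q.
Proof.
move=> h0 h; apply/funext => -[b|//]; have [ba|ab] := ltP b a.
  by rewrite !tr_lt// h.
by rewrite !tr_ge.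
Qed.

Lemma tr_eq_lt a b p q : tr a p = tr a q -> (b < a)%O -> p (Some b) = q (Some b).
Proof. by move=> pq ba; rewrite -(tr_lt _ ba) pq tr_lt. Qed.

Lemma tr_eq_None a p q : tr a p = tr a q -> p None = q None.
Proof. by move=> /(congr1 (fun f => f None)). Qed.

Lemma tr_trl a b p : (a <= b)%O -> tr a (tr b p) = tr a p.
Proof.
by move=> ab; apply: tr_eq => // c ca; rewrite tr_lt//; exact: lt_le_trans ca ab.
Qed.

Lemma tr_eq_le a b p q : (a <= b)%O -> tr b p = tr b q -> tr a p = tr a q.
Proof. by move=> ab pq; rewrite -(tr_trl p ab) pq tr_trl. Qed.

Lemma tr_nbhs a p (U : set P) : nbhs (tr a p) U -> nbhs p [set q | U (tr a q)].
Proof.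
move=> /nbhs_boxP[s [e [e0 h]]]; apply/nbhs_boxP; exists s, e; split=> // q hq.
apply: h => -[b|] /hq //; have [ba|ab] := ltP b a; first by rewrite !tr_lt.
by rewrite !tr_ge// subrr modc0.
Qed.

Lemma tr_all_eq p q : (forall a, tr a p = tr a q) -> p = q.
Proof.
move=> h; apply/funext => -[a|].
  by have [b ab _] := omega1_succ HW a; exact: tr_eq_lt (h b) ab.
by have [b _] := countable_bounded HW (@countable0 W); exact: tr_eq_None (h b).
Qed.

(* Stage [a] is given by the set of points of [X_a] that are blown up to an interval and by the function [F] whose graph is added elsewhere. *)
Definition stage_data := (set P * (P -> C))%type.
Implicit Types (D : W -> stage_data).

(** The cases may overlap: [reg_base] puts the value of the function at a split point at 0, inside
    the interval, so a point may always be continued by following the function. *)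
Definition step_ok D p a :=
  (D a).1 (tr a p) /\ unit_interval (p (Some a)) \/ p (Some a) = (D a).2 (tr a p).

(* Coordinate [None] is the point of the circle, coordinate [Some a] is the one added at stage [a]. *)
Definition tower D : set P := [set p | N (p None) = 1 /\ forall a, step_ok D p a].

(* [tower (restr D a)] is the stage [X_a], embedded with zero coordinates from [a] on; the bonding maps are the [tr a]. *)
Definition restr D a : W -> stage_data :=
  fun b => if (b < a)%O then D b else (set0, fun=> 0).

Lemma restr_lt D a b : (b < a)%O -> restr D a b = D b.
Proof. by rewrite /restr => ->. Qed.

Lemma restr_ge D a b : (a <= b)%O -> restr D a b = (set0, fun=> 0).
Proof. by rewrite /restr leNgt => /negbTE ->. Qed.

Lemma restr_restr D a b : (a <= b)%O -> restr (restr D b) a = restr D a.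
Proof.
move=> ab; apply/funext => c; have [ca|ac] := ltP c a; last by rewrite !restr_ge.
by rewrite !restr_lt//; exact: lt_le_trans ab.
Qed.

Lemma restr_eq D D' a : (forall b, (b < a)%O -> D b = D' b) -> restr D a = restr D' a.
Proof.
move=> h; apply/funext => c; have [ca|ac] := ltP c a; last by rewrite !restr_ge.
by rewrite !restr_lt// h.
Qed.

Lemma tower_restr D a p : N (p None) = 1 ->
  (forall b, (b < a)%O -> step_ok D p b) -> tower (restr D a) (tr a p).
Proof.
move=> p1 h; split=> // b; have [ba|ab] := ltP b a; last first.
  by right; rewrite restr_ge// tr_ge.
have := h b ba; rewrite /step_ok restr_lt// tr_lt// tr_trl//; exact: ltW.
Qed.

Lemma tower_tr D a p : tower D p -> tower (restr D a) (tr a p).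
Proof. by move=> [p1 h]; apply: tower_restr. Qed.

Lemma tower_restr_ge D a b p : tower (restr D a) p -> (a <= b)%O -> p (Some b) = 0.
Proof. by move=> [_ /(_ b)] + ab; rewrite /step_ok restr_ge// => -[[]|]. Qed.

Lemma tower_restr_id D a p : tower (restr D a) p -> tr a p = p.
Proof.
move=> h; apply/funext => -[b|//]; have [ba|ab] := ltP b a; first by rewrite tr_lt.
by rewrite tr_ge// (tower_restr_ge h).
Qed.

(** Common source of [tower_extend], where the coordinates below [b] are prescribed, and of
    [section_exists], where only the circle coordinate is. *)
Lemma fill_coordinates (F : W -> P -> C) (v : W -> option C) (z : C) :
  exists p : P, p None = z /\
    forall a, p (Some a) = if v a is Some w then w else F a (tr a p).
Proof.
pose mk (f : W -> C) : P := fun i => if i is Some a then f a else z.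
have [||f fP] := omega1_rec HW (0 : C) (G := fun a f w =>
    w = if v a is Some w then w else F a (tr a (mk f))).
- move=> a f g w fg ->; case: (v a) => // ; congr (F a _); exact: tr_eq.
- by move=> a f _; eexists.
by exists (mk f); split=> // a; exact: fP.
Qed.

Lemma tower_extend D b y : tower (restr D b) y -> exists q, [/\ tower D q, tr b q = y &
  forall a, (b <= a)%O -> q (Some a) = (D a).2 (tr a q)].
Proof.
move=> ty; have [y1 yok] := ty.
have [q [q0 qP]] := fill_coordinates (fun a => (D a).2)
  (fun a => if (a < b)%O then Some (y (Some a)) else None) (y None).
have qy : tr b q = y.
  by rewrite -(tower_restr_id ty); apply: tr_eq => // a ab; rewrite qP ab.
have qb a : (b <= a)%O -> q (Some a) = (D a).2 (tr a q).
  by move=> ba; rewrite {1}qP ltNge ba.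
exists q; split=> //; split=> [|a]; first by rewrite q0.
have [ab|ba] := ltP a b; last by right; exact: qb.
have := yok a; rewrite /step_ok restr_lt//.
have -> : tr a y = tr a q by rewrite -qy tr_trl// ltW.
by rewrite (qP a) ab.
Qed.

Lemma section_exists D t : exists p : P, p None = circ t /\
  forall a, p (Some a) = (D a).2 (tr a p).
Proof. exact: (fill_coordinates (fun a => (D a).2) (fun=> None) (circ t)). Qed.

(** Pulling functions back along this section replaces measures on the tower by Lebesgue measure in
    the parameter of the circle. *)
Definition sec D t : P := projT1 (cid (section_exists D t)).

Lemma sec_None D t : sec D t None = circ t.
Proof. by rewrite /sec; case: cid => p []. Qed.

Lemma sec_Some D t a : sec D t (Some a) = (D a).2 (tr a (sec D t)).
Proof. by rewrite /sec; case: cid => p []. Qed.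

Lemma sec_unique D t p : p None = circ t ->
  (forall a, p (Some a) = (D a).2 (tr a p)) -> p = sec D t.
Proof.
move=> p0 pS; apply/funext => -[a|]; last by rewrite sec_None.
elim/(omega1_ind HW): a => a IH; rewrite pS sec_Some; congr ((D a).2 _).
by apply: tr_eq; rewrite ?sec_None.
Qed.

Lemma sec_tr D a t : tr a (sec D t) = sec (restr D a) t.
Proof.
apply: sec_unique; first by rewrite tr_None sec_None.
move=> b; have [ba|ab] := ltP b a; last by rewrite restr_ge// tr_ge.
by rewrite tr_lt// restr_lt// tr_trl ?sec_Some// ltW.
Qed.

Lemma sec_tower D t : tower D (sec D t).
Proof.
by split=> [|a]; [rewrite sec_None modc_circ|right; exact: sec_Some].
Qed.

(* The diamond sequence proposes [guess c] at stage [c]. *)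
Variable guess : W -> set P.

Definition guessed D c : set P := tower (restr D c) `&` guess c.

Lemma guessed_restr D a c : (c <= a)%O -> guessed (restr D a) c = guessed D c.
Proof. by move=> ca; rewrite /guessed restr_restr. Qed.

(** [reg_split] gives unique lifts of guessed points; [reg_cont] and [reg_limit] make the tower
    closed, and [reg_bounded] makes it compact; [reg_cluster] carries closures of guessed sets to
    later stages; [reg_analytic] makes the new coordinate analytic; [reg_base] keeps every
    coordinate over a split point in the unit interval. *)
Record regular_at D b (S : set P) (F : P -> C) : Prop := Regular {
  reg_split : forall x, S x -> [/\ tower (restr D b) x,
     forall c, (c <= b)%O -> ~ guessed D c (tr c x) & forall x', S x' -> x' = x];
  reg_cont : forall y, tower (restr D b) y -> ~ S y -> forall e : R, 0 < e ->
     \forall y' \near y, tower (restr D b) y' -> ~ S y' /\ N (F y' - F y) < e;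
  reg_cluster : forall x c, S x -> (c <= b)%O -> closure (guessed D c) (tr c x) ->
     forall s (e : R) U, unit_interval s -> 0 < e -> nbhs x U ->
     exists y, [/\ tower (restr D b) y, U y, guessed D c (tr c y) & N (F y - s) < e];
  reg_limit : forall x, S x -> forall e : R, 0 < e -> \forall y \near x,
     tower (restr D b) y -> y <> x -> exists2 s, unit_interval s & N (F y - s) < e;
  reg_analytic : bounded_limit_closure (fun t => F (sec (restr D b) t));
  reg_bounded : forall y, tower (restr D b) y -> N (F y) <= 5;
  reg_base : forall x, S x -> F x = 0
}.

Definition regular D := forall b, regular_at D b (D b).1 (D b).2.

Lemma regular_at_trivial D b : regular_at D b set0 (fun=> 0).
Proof.
split=> //.
- by move=> y _ _ e e0; apply: nbhs_all => y' _; split=> //; rewrite subrr modc0.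
- exact: BLC_const.
- by move=> *; rewrite modc0.
Qed.

(** Regularity at [b] sees only the stages before [b], as the recursion in [tower_exists]
    requires. *)
Lemma regular_at_congr D D' b S F : restr D b = restr D' b ->
  regular_at D b S F -> regular_at D' b S F.
Proof.
move=> DD'; have gD c : (c <= b)%O -> guessed D c = guessed D' c.
  by move=> cb; rewrite -(guessed_restr D cb) DD' guessed_restr.
case; rewrite DD' => h1 h2 h3 h4 h5 h6 h7; split=> //.
  by move=> x /h1[? h ?]; split=> // c cb; rewrite -gD//; exact: h.
by move=> x c Sx cb; rewrite -gD//; exact: h3.
Qed.

Lemma regular_restr D a : (forall b, (b < a)%O -> regular_at D b (D b).1 (D b).2) ->
  regular (restr D a).
Proof.
move=> rD b; have [ba|ab] := ltP b a; last first.
  by rewrite restr_ge//; exact: regular_at_trivial.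
rewrite restr_lt//; apply: regular_at_congr (rD b ba); by rewrite restr_restr// ltW.
Qed.

(** Induction on the coordinate. Off a split point the function is continuous and no nearby point is
    split. Over a split point, nearby points of the tower have their coordinate in the interval or,
    by [reg_limit], close to it. *)
Lemma tower_closed D : regular D -> closed (tower D).
Proof.
move=> rD p clp.
have p1 : N (p None) = 1.
  apply/eqP; rewrite -subr_eq0 -normr_eq0 eq_le normr_ge0 andbT.
  apply/ler_addgt0Pr => e e0; rewrite add0r.
  have [q [[q1 _] /= pq]] := clp _ (nbhs_coord p None e0).
  have := modc_lerB_dist (p None) (q None); have := modc_lerB_dist (q None) (p None).
  rewrite (modc_distC (p None)) q1 ler_norml; lra.
split=> // a; elim/(omega1_ind HW): a => a IH.
have tp : tower (restr D a) (tr a p) by exact: tower_restr.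
have [h1 h2 _ h4 _ _ h7] := rD a.
have [Sp|nSp] := pselect ((D a).1 (tr a p)); [left; split=> //|right].
  apply: unit_interval_closed => e e0; have e2 : 0 < e / 2 by lra.
  have [q [tq [/= V pq]]] := clp _ (filterI (tr_nbhs (h4 _ Sp _ e2)) (nbhs_coord p (Some a) e2)).
  case: (tq.2 a) => [[_ qI]|qF].
    by exists (q (Some a)) => //; rewrite modc_distC; lra.
  have [tqp|tqp] := pselect (tr a q = tr a p).
    exists 0; first exact: unit_interval0.
    by move: qF pq; rewrite tqp (h7 _ Sp) => ->; rewrite modc_distC; lra.
  have [s sI sF] := V (tower_tr a tq) tqp; exists s => //.
  have := modc_dist_triangle (q (Some a)) (p (Some a)) s.
  by rewrite {2}qF (modc_distC (p (Some a)) (q (Some a))); lra.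
apply/eqP; rewrite -subr_eq0 -modc_eq0 eq_le modc_ge0 andbT.
apply/ler_addgt0Pr => e e0; rewrite add0r; have e2 : 0 < e / 2 by lra.
have [q [tq [/= V pq]]] := clp _ (filterI (tr_nbhs (h2 _ tp nSp _ e2)) (nbhs_coord p (Some a) e2)).
have [nSq qF] := V (tower_tr a tq).
case: (tq.2 a) => [[/nSq//]|qE].
have := modc_dist_triangle (q (Some a)) (p (Some a)) ((D a).2 (tr a p)).
by rewrite {2}qE (modc_distC (p (Some a)) (q (Some a))); lra.
Qed.

Lemma tower_compact D : regular D -> compact (tower D).
Proof.
move=> rD; apply: subclosed_compact (tower_closed rD) (compact_box (M := 5)) _.
move=> p tp i; suff h : N (p i) <= 5.
  by split; apply: le_trans h; [exact: normr_Re_le|exact: normr_Im_le].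
case: i => [a|]; last by rewrite tp.1; lra.
have [_ _ _ _ _ h6 _] := rD a.
case: (tp.2 a) => [[_ [pI /andP[p0 p1]]]|->]; last exact/h6/tower_tr.
by apply: le_trans (modc_le_ReIm _) _; rewrite pI normr0 addr0 ger0_norm//; lra.
Qed.

(** A basic neighbourhood involves finitely many coordinates, so [b] can be reached from the last
    relevant stage [a] below it. This treats successors and limits alike. *)
Lemma coordinate_bound (s : seq (option W)) c b :
  (c < b)%O -> exists a, [/\ (c <= a)%O, (a < b)%O &
    forall a', Some a' \in s -> (a' < b)%O -> (a' <= a)%O].
Proof.
move=> cb; elim: s => [|[a'|] s [a [ca ab h]]]; first by exists c.
  have [a'b|ba'] := ltP a' b.
    exists (Order.max a a'); split; rewrite ?le_max ?ca// ?gt_max ?ab//.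
    move=> a''; rewrite inE => /orP[/eqP[->] _|]; first by rewrite le_max lexx orbT.
    by move=> /h /[apply]; rewrite le_max => ->.
  exists a; split=> // a''; rewrite inE => /orP[/eqP[->]|/h//].
  by rewrite ltNge ba'.
by exists a; split=> // a''; rewrite inE => /h.
Qed.

Lemma coordinates_bounded (s : seq (option W)) c : exists2 b, (c < b)%O &
  forall a, Some a \in s -> (a < b)%O.
Proof.
elim: s => [|[a'|] s [b cb h]]; first by have [b ? _] := omega1_succ HW c; exists b.
  have [b' bb' _] := omega1_succ HW (Order.max b a'); move: bb'; rewrite gt_max => /andP[bb' a'b'].
  exists b'; first exact: lt_trans bb'.
  move=> a; rewrite inE => /orP[/eqP[->//]|/h ab]; exact: lt_trans bb'.
by exists b => // a; rewrite inE => /h.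
Qed.

(** With [a] the last relevant stage below [b], it is enough to find a point [y] over the guessed
    set, near [tr a p], whose function value is near [p (Some a)], and then to extend [y] by
    following the functions. If [tr a p] is split, [reg_cluster] provides [y]; otherwise the
    induction hypothesis and continuity do. *)
Lemma closure_lift_stage D c p b : regular D -> tower D p ->
  closure (guessed D c) (tr c p) -> (c <= b)%O -> forall U, nbhs (tr b p) U ->
  exists y, [/\ tower (restr D b) y, U y & guessed D c (tr c y)].
Proof.
move=> rD tp clp; elim/(omega1_ind HW): b => b IH; rewrite le_eqVlt => /orP[/eqP<-|cb] U pU.
  have [y [[ty gy] Uy]] := clp _ pU; exists y; split=> //; rewrite (tower_restr_id ty); by split.
move: pU => /nbhs_boxP[s [e [e0 sU]]].
have [a [ca ab hs]] := coordinate_bound s cb.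
pose V := [set q : P | forall i, i \in s -> N (q i - tr a p i) < e].
have pV : nbhs (tr a p) V by apply/nbhs_boxP; exists s, e.
suff [y [ty Vy gy Fy]] : exists y, [/\ tower (restr D a) y, V y, guessed D c (tr c y) &
    N ((D a).2 y - p (Some a)) < e].
  have [|q [tq qy qF]] := @tower_extend (restr D b) a y; first by rewrite restr_restr// ltW.
  exists q; split=> //; last by rewrite -(tr_trl q ca) qy.
  apply: sU => -[a'|] si; last by have := Vy _ si; rewrite -qy.
  have [a'b|ba'] := ltP a' b; last by rewrite tr_ge// (tower_restr_ge tq)// subrr modc0.
  rewrite tr_lt//; have := hs _ si a'b; rewrite le_eqVlt => /orP[/eqP->|a'a].
    by rewrite qF// restr_lt// qy.
  by have := Vy _ si; rewrite -qy !tr_lt.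
have [h1 h2 h3 _ _ _ h7] := rD a.
have [Sp|nSp] := pselect ((D a).1 (tr a p)).
  have pI : unit_interval (p (Some a)).
    by case: (tp.2 a) => [[]//|->]; rewrite (h7 _ Sp); exact: unit_interval0.
  have clp' : closure (guessed D c) (tr c (tr a p)) by rewrite tr_trl.
  by have [y [? ? ? ?]] := h3 _ c Sp ca clp' _ _ _ pI e0 pV; exists y.
have pF : p (Some a) = (D a).2 (tr a p) by case: (tp.2 a) => // -[].
have [y [ty [Vy Fy] gy]] := IH a ab ca _ (filterI pV (h2 _ (tower_tr a tp) nSp _ e0)).
by exists y; split=> //; have [_] := Fy ty; rewrite pF.
Qed.

Lemma closure_lift D c p : regular D -> tower D p ->
  closure (guessed D c) (tr c p) -> forall U, nbhs p U ->
  exists q, [/\ tower D q, U q & guessed D c (tr c q)].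
Proof.
move=> rD tp clp U /nbhs_boxP[s [e [e0 sU]]].
have [b cb hs] := coordinates_bounded s c.
have [|y [ty Vy gy]] := closure_lift_stage rD tp clp (ltW cb)
    (U := [set q : P | forall i, i \in s -> N (q i - tr b p i) < e]).
  by apply/nbhs_boxP; exists s, e.
have [q [tq qy _]] := tower_extend ty; exists q; split=> //; last first.
  by rewrite -(tr_trl q (ltW cb)) qy.
apply: sU => i si; have := Vy _ si; rewrite -qy; case: i si => // a /hs ab.
by rewrite !tr_lt.
Qed.

(** No point over a guessed point of stage [c] is split at a stage from [c] on, so every coordinate
    from [c] on is forced. *)
Lemma unique_lift D c p q : regular D -> tower D p -> tower D q ->
  tr c p = tr c q -> guessed D c (tr c p) -> p = q.
Proof.
move=> rD tp tq pq gp; have pq0 := tr_eq_None pq.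
apply/funext => -[a|//]; elim/(omega1_ind HW): a => a IH.
have [ac|ca] := ltP a c; first exact: tr_eq_lt pq ac.
have pqa : tr a p = tr a q by exact: tr_eq.
have [h1 _ _ _ _ _ _] := rD a.
have nS : ~ (D a).1 (tr a p).
  by move=> /h1[_ /(_ c ca)]; rewrite tr_trl.
case: (tp.2 a) => [[//]|->]; rewrite pqa.
by case: (tq.2 a) => [[]|->//]; rewrite -pqa.
Qed.

End Tower.

(** * Peak points *)

Section Peak.
Context {R : realType} {d : Order.disp_t} {W : orderType d}.
Hypothesis HW : is_omega1 W.
Local Notation C := R[i].
Local Notation N := (@modc R).
Local Notation P := (prod_topology (fun _ : option W => R[i]^o : topologicalType)).
Local Notation HH := bounded_limit_closure.
Implicit Types (a b : W) (p q x y : P) (D : W -> @stage_data R d W).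
Variable guess : W -> set P.
Local Notation regular := (regular HW guess).
Local Notation sec := (sec HW).

(** Takes the place of the algebra generated by the coordinates: it contains them, is closed under
    sums and products, and admits the dominated series of [analytic_series]. *)
Definition analytic D (f : P -> C) :=
  cont_on (tower D) f /\ HH (fun t => f (sec D t)).

Lemma analytic_cst D c : analytic D (fun=> c).
Proof. by split; [exact: cont_on_cst|exact: BLC_const]. Qed.

Lemma analyticD D f g : analytic D f -> analytic D g -> analytic D (fun x => f x + g x).
Proof. by move=> [cf hf] [cg hg]; split; [exact: cont_onD|exact: BLC_add]. Qed.

Lemma analyticM D f g : analytic D f -> analytic D g -> analytic D (fun x => f x * g x).
Proof. by move=> [cf hf] [cg hg]; split; [exact: cont_onM|exact: BLC_mul]. Qed.

Lemma analyticX D f n : analytic D f -> analytic D (fun x => f x ^+ n).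
Proof.
move=> af; elim: n => [|n IH].
  by rewrite (_ : (fun x => _) = fun=> 1); [exact: analytic_cst|apply/funext => x; rewrite expr0].
rewrite (_ : (fun x => _) = fun x => f x * f x ^+ n); first exact: analyticM.
by apply/funext => x; rewrite exprS.
Qed.

Lemma analytic_poly D f (u : {poly C}) : analytic D f -> analytic D (fun x => u.[f x]).
Proof.
move=> af; elim/poly_ind: u => [|u c IH].
  rewrite (_ : (fun x => _) = fun=> 0); first exact: analytic_cst.
  by apply/funext => x; rewrite horner0.
rewrite (_ : (fun x => _) = fun x => u.[f x] * f x + c); last first.
  by apply/funext => x; rewrite !hornerE.
by apply: analyticD; [exact: analyticM|exact: analytic_cst].
Qed.

Lemma cont_on_coord (K : set P) i : cont_on K (fun x : P => x i).
Proof. by move=> p _ e e0; apply: filterS (nbhs_coord p i e0) => q. Qed.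

Lemma analytic_None D : analytic D (fun x => x None).
Proof.
split; first exact: cont_on_coord.
rewrite (_ : (fun t => _) = circ); first exact: BLC_circ.
by apply/funext => t; rewrite sec_None.
Qed.

Lemma analytic_Some D a : regular D -> analytic D (fun x => x (Some a)).
Proof.
move=> rD; split; first exact: cont_on_coord.
rewrite (_ : (fun t => _) = fun t => (D a).2 (sec (restr D a) t)).
  by have [_ _ _ _ h _ _] := rD a.
by apply/funext => t; rewrite sec_Some -sec_tr.
Qed.

Lemma analytic_series D (u : nat -> P -> C) (M : R) :
  (forall n, analytic D (u n)) ->
  (forall n x, tower D x -> N (u n x) <= M * hp n.+1) ->
  exists2 G, analytic D G &
    forall n x, tower D x -> N (G x - \sum_(k < n) u k x) <= M * hp n.
Proof.
move=> au uM; pose S n x := \sum_(k < n) u k x.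
have aS n : analytic D (S n).
  elim: n => [|n IH].
    rewrite (_ : S 0%N = fun=> 0); first exact: analytic_cst.
    by apply/funext => x; rewrite /S big_ord0.
  rewrite (_ : S n.+1 = fun x => S n x + u n x); first exact: analyticD.
  by apply/funext => x; rewrite /S big_ord_recr.
have SB n m x : tower D x -> (n <= m)%N -> N (S m x - S n x) <= M * hp n - M * hp m.
  move=> tx /subnK <-; elim: (m - n)%N => [|k IH]; first by rewrite add0n !subrr modc0.
  rewrite addSn; apply: le_trans (modc_dist_triangle (S (k + n)%N x) _ _) _.
  have -> : S (k + n).+1 x - S (k + n)%N x = u (k + n)%N x.
    by rewrite /S big_ord_recr/= addrAC subrr add0r.
  have := uM (k + n)%N x tx; have := @hpS R (k + n)%N; nra.
have M0 : 0 <= M.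
  have := uM 0%N _ (sec_tower HW D 0); have := modc_ge0 (u 0%N (sec D 0)).
  by move=> /le_trans/[apply]; rewrite pmulr_lge0 ?hp_gt0.
have SB' n m x : tower D x -> (n <= m)%N -> N (S m x - S n x) <= M * hp n.
  by move=> tx /(SB _ _ _ tx) h; apply: le_trans h _; rewrite gerBl mulr_ge0// ltW// hp_gt0.
have small e : 0 < e -> exists n, M * hp n < e.
  move=> e0; have [n h] := @hp_small R (e / (M + 1)) ltac:(by apply: divr_gt0 => //; lra).
  exists n; have := h n (leqnn n); rewrite ltr_pdivlMr; last by lra.
  by have := @hp_gt0 R n; nra.
have /choice[G GP] x : exists l, tower D x ->
    cvgc (fun n => S n x) l /\ forall n, N (l - S n x) <= M * hp n.
  have [tx|nt] := pselect (tower D x); last by exists 0.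
  have [l h] := cauchy_cvgc small (fun n m => SB' n m x tx).
  by exists l.
exists G; last by move=> n x /GP[_]; exact.
split.
  apply: (cont_on_uniform (f_ := S)) => [n|e /small[n h]]; first by have [] := aS n.
  by exists n => x /GP[_ /(_ n) h']; apply: le_trans h' (ltW h).
apply: (@BLC_lim R (fun n t => S n (sec D t)) _ (M * hp 0)).
- by move=> n; have [] := aS n.
- move=> n t; have := SB' 0%N n _ (sec_tower HW D t) (leq0n n).
  by rewrite {2}/S big_ord0 subr0.
- by move=> t; have [] := GP _ (sec_tower HW D t).
Qed.

Lemma series_modc_le D (u : nat -> P -> C) (M : R) G x (c : R) :
  tower D x -> (forall n x, tower D x -> N (G x - \sum_(k < n) u k x) <= M * hp n) ->
  (exists m, forall n, (m <= n)%N -> N (\sum_(k < n) u k x) <= c) -> N (G x) <= c.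
Proof.
move=> tx h [m hm]; apply/ler_addgt0Pr => e e0.
have M0 : 0 <= M.
  have := h 0%N x tx; rewrite /hp expr0 mulr1; exact: le_trans (modc_ge0 _).
have [n hn] := @hp_small R (e / (M + 1)) ltac:(by apply: divr_gt0 => //; lra).
pose k := maxn m n.
have := h k x tx; have := hm k (leq_maxl _ _); have := hn k (leq_maxr _ _).
rewrite ltr_pdivlMr; last by lra.
have := modc_lerB_dist (G x) (\sum_(k < k) u k x).
have := @hp_gt0 R k; nra.
Qed.

Lemma sum_hp n : \sum_(k < n) hp k.+1 = 1 - hp n :> R.
Proof.
elim: n => [|n IH]; first by rewrite big_ord0 /hp expr0 subrr.
by rewrite big_ord_recr/= IH; have := @hpS R n; lra.
Qed.

Lemma series_eq D (u : nat -> P -> C) (M : R) G q (v : C) :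
  tower D q -> (forall n x, tower D x -> N (G x - \sum_(k < n) u k x) <= M * hp n) ->
  (forall n, u n q = (hp n.+1)%:C%C * v) -> G q = v.
Proof.
move=> tq h uv; apply/eqP; rewrite -subr_eq0 -modc_eq0 eq_le modc_ge0 andbT.
apply/ler_addgt0Pr => e e0; rewrite add0r.
have M0 : 0 <= M.
  have := h 0%N q tq; rewrite /hp expr0 mulr1; exact: le_trans (modc_ge0 _).
have v0 := modc_ge0 v.
have [n hn] := @hp_small R (e / (M + N v + 1)) ltac:(by apply: divr_gt0 => //; lra).
have := hn n (leqnn n); rewrite ltr_pdivlMr; last by lra.
have := h n q tq; have := @hp_gt0 R n.
have -> : \sum_(k < n) u k q = (1 - hp n)%:C%C * v.
  rewrite (eq_bigr (fun k : 'I_n => (hp k.+1)%:C%C * v)) => [|k _]; last exact: uv.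
  by rewrite -mulr_suml -raddf_sum/= sum_hp.
have := modc_dist_triangle ((1 - hp n)%:C%C * v) (G q) v.
have -> : N ((1 - hp n)%:C%C * v - v) = hp n * N v.
  rewrite rmorphB rmorph1 mulrBl mul1r addrAC subrr add0r modcN modcM modc_real.
  by rewrite ger0_norm// ltW// hp_gt0.
nra.
Qed.

Definition peaks_on D (E : set P) (h : P -> C) := [/\ analytic D h,
  (forall q, tower D q -> E q -> h q = 1) &
  (forall q, tower D q -> ~ E q -> N (h q) < 1)].

Lemma peaks_on_le1 D E h q : peaks_on D E h -> tower D q -> N (h q) <= 1.
Proof.
move=> [_ h1 h2] tq; have [Eq|/h2 h3] := pselect (E q); first by rewrite h1// modc1.
exact/ltW/h3.
Qed.

(** The mean of the [h n] with weights [hp n.+1], of total 1. If [q] is outside [E m], the deficit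
    [hp m.+1 * (1 - N (h m q))] of that one term survives in the sum. *)
Lemma peaks_on_bigcap D (E : nat -> set P) (h : nat -> P -> C) :
  (forall n, peaks_on D (E n) (h n)) -> exists g, peaks_on D (\bigcap_n E n) g.
Proof.
move=> hE; pose u n x := (hp n.+1)%:C%C * h n x.
have au n : analytic D (u n) by apply: analyticM; [exact: analytic_cst|have [] := hE n].
have uM n x : tower D x -> N (u n x) <= 1 * hp n.+1.
  move=> tx; rewrite modcM modc_real ger0_norm ?(ltW (hp_gt0 _))// mulrC.
  by rewrite ler_wpM2r ?(ltW (hp_gt0 _))//; apply: peaks_on_le1 (hE n) tx.
have [G aG hG] := analytic_series au uM.
exists G; split=> // q tq.
  move=> Eq; apply: (series_eq tq hG) => n; rewrite /u.
  by have [_ -> //] := hE n; exact: Eq.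
move=> /existsNP[m /not_implyP[_ nE]].
have hm : N (h m q) < 1 by have [_ _] := hE m; exact.
apply: (@le_lt_trans _ _ (1 - hp m.+1 * (1 - N (h m q)))); last first.
  by rewrite gtrBl mulr_gt0 ?hp_gt0// subr_gt0.
apply: (series_modc_le tq hG); exists m.+1 => n /subnK <-.
suff : N (\sum_(k < n - m.+1 + m.+1) u k q) <=
    1 - hp (n - m.+1 + m.+1)%N - hp m.+1 * (1 - N (h m q)).
  by have := @hp_gt0 R (n - m.+1 + m.+1)%N; lra.
have Nu k : N (u k q) <= hp k.+1 by have := uM k q tq; rewrite mul1r.
elim: (n - m.+1)%N => [|k IH].
  rewrite add0n big_ord_recr/=; apply: le_trans (modc_triangle _ _) _.
  rewrite modcM modc_real ger0_norm ?(ltW (hp_gt0 _))//.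
  suff : N (\sum_(k < m) u k q) <= 1 - hp m by have := @hpS R m; lra.
  rewrite -sum_hp; elim: m {nE hm} => [|m IH]; first by rewrite !big_ord0 modc0.
  by rewrite !big_ord_recr/=; apply: le_trans (modc_triangle _ _) _; apply: lerD.
rewrite addSn big_ord_recr/=; apply: le_trans (modc_triangle _ _) _.
by have := Nu (k + m.+1)%N; have := @hpS R (k + m.+1)%N; lra.
Qed.

(* Bishop's construction: the sum of [2^-(n+1) f h^(k_n)], with [k_n] so large that [h^(k_n)] is small where [f] exceeds [1 + 2^-(n+2)]. *)
Lemma peaks_on_bishop D E h (f : P -> C) : compact (tower D) ->
  peaks_on D E h -> analytic D f ->
  (forall q, tower D q -> E q -> f q = 1 \/ N (f q) < 1) ->
  exists g, peaks_on D (E `&` [set q | f q = 1]) g.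
Proof.
move=> cD hE af fE; have [[ch hh] h1 h2] := hE; have [cf _] := af.
have [M0 hM0] := compact_modc_bounded cD cf.
pose M := `|M0| + 1.
have M1 : 1 <= M by rewrite lerDr.
have fM q : tower D q -> N (f q) <= M.
  by move=> /hM0 H; apply: le_trans H _; apply: le_trans (ler_norm _) _; rewrite lerDl.
have /choice[kk kkP] n : exists k : nat, (0 < k)%N /\ forall q, tower D q ->
    1 + hp n.+2 <= N (f q) -> N (h q) ^+ k <= (4 * M)^-1.
  have [q tq fq|r r01 hr] := compact_strict_bound (c := 1 + hp n.+2) cD cf ch.
    apply: h2 => // Eq; have := @hp_gt0 R n.+2.
    by case: (fE q tq Eq) fq => [->|]; rewrite ?modc1; lra.
  have M4 : 0 < (4 * M)^-1 by rewrite invr_gt0; lra.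
  have [k0 hk0] := pow_small r01 M4.
  exists k0.+1; split=> // q tq fq; apply: le_trans (ltW (hk0 k0.+1 (leqnSn _))).
  by apply: lerXn2r; [rewrite nnegrE modc_ge0|case/andP: r01|exact: hr].
pose u n x := (hp n.+1)%:C%C * (f x * h x ^+ kk n).
have Nu n q : N (u n q) = hp n.+1 * (N (f q) * N (h q) ^+ kk n).
  by rewrite !modcM modcX modc_real ger0_norm// ltW// hp_gt0.
have hle q n : tower D q -> 0 <= N (h q) ^+ n <= 1.
  by move=> tq; rewrite exprn_ge0 ?modc_ge0// exprn_ile1 ?modc_ge0//; exact: peaks_on_le1 hE tq.
have au n : analytic D (u n).
  by apply: analyticM (analytic_cst _ _) _; apply: analyticM => //; apply: analyticX; have [] := hE.
have uM n x : tower D x -> N (u n x) <= M * hp n.+1.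
  move=> tx; rewrite Nu mulrC ler_wpM2r ?(ltW (hp_gt0 _))//.
  have := fM x tx; have := hle x (kk n) tx; have := modc_ge0 (f x); nra.
have [G aG hG] := analytic_series au uM.
have GE q : tower D q -> E q -> G q = f q.
  by move=> tq Eq; apply: (series_eq tq hG) => n; rewrite /u h1// expr1n mulr1.
exists G; split=> // q tq.
  by move=> [Eq fq]; rewrite GE.
move=> nE; have [Eq|nEq] := pselect (E q).
  rewrite GE//; case: (fE q tq Eq) => // fq; case: nE; by split.
have hq := h2 q tq nEq; have hq0 := modc_ge0 (h q).
have [f1|f1] := leP (N (f q)) 1.
  apply: (@le_lt_trans _ _ (N (h q))) => //.
  apply: (series_modc_le tq hG); exists 0%N => n _.
  suff : N (\sum_(k < n) u k q) <= N (h q) * (1 - hp n).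
    by have := @hp_gt0 R n; nra.
  rewrite -sum_hp; elim: n => [|n IH]; first by rewrite !big_ord0 modc0 mulr0.
  rewrite !big_ord_recr/=; apply: le_trans (modc_triangle _ _) _; rewrite mulrDr.
  apply: lerD => //; rewrite Nu mulrC ler_wpM2r ?(ltW (hp_gt0 _))//.
  have [k0 _] := kkP n; rewrite -(prednK k0) exprS.
  have /andP[X0 X1] := hle q (kk n).-1 tq; rewrite -[leRHS]mul1r.
  by apply: ler_pM; rewrite ?modc_ge0 ?mulr_ge0// ler_piMr.
(* For the least such [m], the terms before [m] see [N (f q) <= 1 + hp m / 2] and sum to at most
   [(1 - hp m) * (1 + hp m / 2)]. Those from [m] on are damped by the factor 1/4 and add at most
   [hp m / 4]. The total is at most [1 - hp m / 4]. *)
have ex : exists m, 1 + hp m.+2 <= N (f q).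
  have [m hm] := @hp_small R (N (f q) - 1) ltac:(lra).
  by exists m; have := hm m.+2 (leqW (leqnSn m)); lra.
case: (ex_minnP ex) => m hm mmin.
have hpm := @hp_gt0 R m; have hpm1 := @hp_le1 R m.
apply: (@le_lt_trans _ _ (1 - hp m / 4)); last by lra.
have base n : (n <= m)%N -> N (\sum_(k < n) u k q) <= (1 - hp n) * (1 + hp m / 2).
  rewrite -sum_hp; elim: n => [|n IH nm]; first by rewrite !big_ord0 modc0 mul0r.
  rewrite !big_ord_recr/=; apply: le_trans (modc_triangle _ _) _; rewrite mulrDl.
  apply: lerD; first by apply: IH; exact: ltnW.
  rewrite Nu ler_wpM2l ?(ltW (hp_gt0 _))//.
  have fq : N (f q) <= 1 + hp m / 2.
    have m0 : (0 < m)%N by exact: leq_ltn_trans (leq0n n) nm.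
    have : ~~ (1 + hp m.-1.+2 <= N (f q)).
      by apply/negP => /mmin; rewrite -ltnS prednK// ltnn.
    rewrite prednK//.
    by rewrite -ltNge; have := @hpS R m; lra.
  have := hle q (kk n) tq; nra.
apply: (series_modc_le tq hG); exists m => n /subnK <-.
suff : N (\sum_(k < n - m + m) u k q) <= 1 - hp m / 2 + (hp m - hp (n - m + m)%N) / 4.
  by have := @hp_gt0 R (n - m + m)%N; lra.
elim: (n - m)%N => [|k IH]; first by rewrite add0n; have := base m (leqnn m); nra.
rewrite addSn big_ord_recr/=; apply: le_trans (modc_triangle _ _) _.
have [_ /(_ q tq)] := kkP (k + m)%N.
have -> : 1 + hp (k + m).+2 <= N (f q).
  by apply: le_trans hm; rewrite lerD2l; apply: hp_le; rewrite !ltnS leq_addl.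
move=> /(_ isT) hk; rewrite Nu.
have fh : N (f q) * N (h q) ^+ kk (k + m)%N <= 4^-1.
  have -> : 4^-1 = M * (4 * M)^-1.
    by rewrite invfM mulrCA divff ?mulr1//; apply: lt0r_neq0; lra.
  by apply: ler_pM; rewrite ?modc_ge0 ?exprn_ge0 ?modc_ge0//; exact: fM.
have := @hpS R (k + m)%N; have := @hp_gt0 R (k + m).+1; nra.
Qed.

Lemma unit_circle_peak (z : C) : N z = 1 -> N ((1 + z) / 2) <= 1 /\
  (N ((1 + z) / 2) = 1 -> z = 1).
Proof.
have N2 : N (2 : C)^-1 = 2^-1.
  rewrite (_ : (2 : C)^-1 = (2^-1 : R)%:C%C); last by rewrite fmorphV rmorph_nat.
  by rewrite modc_real ger0_norm// invr_ge0.
move=> z1; rewrite modcM N2; split.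
  by have := modc_triangle 1 z; rewrite z1 modc1; lra.
move=> h; have {}h : N (1 + z) = 2 by lra.
case: z z1 h => a b; rewrite /modc/= => h1 h2.
have e1 : a ^+ 2 + b ^+ 2 = 1.
  by rewrite -[RHS](expr1n _ 2) -h1 sqr_sqrtr// addr_ge0// sqr_ge0.
have e2 : (1 + a) ^+ 2 + (0 + b) ^+ 2 = 2 ^+ 2.
  by rewrite -h2 sqr_sqrtr// addr_ge0// sqr_ge0.
have a1 : a = 1 by nra.
have b0 : b = 0 by apply/eqP; rewrite -sqrf_eq0; apply/eqP; nra.
by rewrite a1 b0.
Qed.

(** The set is the intersection over the countably many [b < a] of the sets where [q] agrees with
    [p] up to and including coordinate [b], so successors and limits need no distinction. Each of
    these is a peak set by Bishop's construction inside the peak set that the induction gives for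
    [b]. *)
Lemma peak_point D p a : regular D -> tower D p ->
  exists h, peaks_on D [set q | tr a q = tr a p] h.
Proof.
move=> rD tp; have cD := tower_compact rD.
have [h0 h0P] : exists h, peaks_on D [set q | q None = p None] h.
  pose f x := (1 + (p None)^*%C * x None) / 2 : C.
  have pp : p None * (p None)^*%C = 1.
    by rewrite -sqr_normc normc_def; move: tp.1; rewrite /modc; case: (p None) => u v /= ->; rewrite expr1n.
  have fN q : tower D q -> N ((p None)^*%C * q None) = 1.
    move=> [q1 _]; rewrite modcM q1 mulr1.
    by have := congr1 N pp; rewrite modcM tp.1 mul1r modc1.
  have q1 (q : P) : (p None)^*%C * q None = 1 -> q None = p None.
    by move=> h; rewrite -[LHS]mul1r -pp -mulrA h mulr1.
  exists f; split.
  - apply: analyticM (analytic_cst _ _); apply: analyticD; first exact: analytic_cst.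
    apply: analyticM; [exact: analytic_cst|exact: analytic_None].
  - move=> q tq /= qp; rewrite /f qp [_^*%C * _]mulrC pp -[1 + 1]/2.
    by rewrite divff// pnatr_eq0.
  - move=> q tq nq; have [le1 eq1] := unit_circle_peak (fN q tq).
    rewrite lt_neqAle le1 andbT; apply/eqP => /eq1 /q1; exact: nq.
elim/(omega1_ind HW): a => a IH.
have peaks_ext (E E' : set P) h : (forall q, tower D q -> E q <-> E' q) ->
    peaks_on D E h -> peaks_on D E' h.
  by move=> EE' [h1 h2 h3]; split=> // q tq; rewrite -EE'//; [exact: h2|exact: h3].
have step b : exists h, (b < a)%O -> peaks_on D
    ([set q | tr b q = tr b p] `&` [set q | q (Some b) = p (Some b)]) h.
  have [ba|ab] := pselect (b < a)%O; last by exists h0.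
  have [h hP] := IH b ba.
  have [_ _ _ _ _ _ h7] := rD b.
  have [Sp|nSp] := pselect ((D b).1 (tr b p)); last first.
    exists h => _; apply: peaks_ext hP => q tq; split=> [qp|[]//]; split=> //=.
    by case: (tq.2 b) (tp.2 b) => [[+ _]|->] [[+ _]|->]; rewrite qp.
  (* On the peak set for [b] both coordinates are in [0, 1], so [f] is 1 at equality and smaller in
     modulus otherwise. Off that set [f] may exceed 1, which is what [peaks_on_bishop] repairs. *)
  pose f x : C := 1 + (-1) * (x (Some b) - p (Some b)) ^+ 2.
  have af : analytic D f.
    apply: analyticD (analytic_cst _ _) _; apply: analyticM (analytic_cst _ _) _.
    apply: analyticX; apply: analyticD (analytic_cst _ _); exact: analytic_Some.
  have inI q : tower D q -> tr b q = tr b p -> unit_interval (q (Some b)).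
    move=> tq qp; case: (tq.2 b) => [[]//|->].
    by rewrite qp h7//; exact: unit_interval0.
  have f1 (z w : C) : unit_interval z -> unit_interval w ->
      z = w \/ N (1 + (-1) * (z - w) ^+ 2) < 1.
    have ure (v : C) : unit_interval v -> exists2 u : R, 0 <= u <= 1 & v = u%:C%C.
      by case: v => u ? [/= -> uI]; exists u.
    move=> /ure[{}z zI ->] /ure[{}w wI ->].
    have [->|zw] := eqVneq z w; [by left|right].
    rewrite (_ : 1 + _ = (1 - (z - w) ^+ 2)%:C%C); last first.
      by rewrite rmorphB rmorph1 rmorphXn rmorphB mulN1r.
    rewrite modc_real; have : 0 < (z - w) ^+ 2 by rewrite lt_neqAle sqr_ge0 eq_sym sqrf_eq0 subr_eq0 zw.
    by rewrite ltr_norml; nra.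
  have fH q : tower D q -> [set q | tr b q = tr b p] q -> f q = 1 \/ N (f q) < 1.
    move=> tq /= qp; case: (f1 _ _ (inI q tq qp) (inI p tp erefl)) => [e|]; last by right.
    by left; rewrite /f e subrr expr0n mulr0 addr0.
  have [g gP] := peaks_on_bishop cD hP af fH.
  exists g => _; apply: peaks_ext gP => q tq; split=> -[/= qp]; last first.
    by move=> e; split=> //=; rewrite /f e subrr expr0n mulr0 addr0.
  move=> fq; split=> //=; case: (f1 _ _ (inI q tq qp) (inI p tp erefl)) => //.
  by rewrite -/(f q) fq modc1 ltxx.
have {step} /choice[h hP] := step.
have /countable_injP[i iinj] : countable (initial_segment a) by have [_ _] := HW.
(* [i] numbers the [b < a]; a natural number that codes no [b] contributes only the condition on the
   circle coordinate, for which [h0] peaks. *)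
pose E n := [set q : P | q None = p None /\ forall b, (b < a)%O -> i b = n ->
  tr b q = tr b p /\ q (Some b) = p (Some b)].
have /choice[g gP] n : exists g, peaks_on D (E n) g.
  have [[b [ba ib]]|nb] := pselect (exists b, (b < a)%O /\ i b = n).
    exists (h b); apply: peaks_ext (hP b ba) => q tq; split=> [[/= q1 q2]|[_ /(_ b ba ib)]//].
    split; first exact: tr_eq_None q1.
    by move=> c ca ic; have -> : c = b by apply: iinj; rewrite ?ib//; exact/mem_set.
  exists h0; apply: peaks_ext h0P => q tq; split=> [/= q0|[]//]; split=> // b ba ib.
  by case: nb; exists b.
have [G GP] := peaks_on_bigcap gP; exists G; apply: peaks_ext GP => q tq; split.
  move=> qE; apply: tr_eq; first by have [] := qE 0%N I.
  by move=> b ba; have [_ /(_ b ba erefl)[]] := qE (i b) I.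
move=> /= qp n _; split=> [|b ba _]; first exact: tr_eq_None qp.
by split; [exact: tr_eq_le (ltW ba) qp|exact: tr_eq_lt qp ba].
Qed.

End Peak.

(** * Splitting a point *)

Section Construction.
Context {R : realType} {d : Order.disp_t} {W : orderType d}.
Hypothesis HW : is_omega1 W.
Local Notation C := R[i].
Local Notation N := (@modc R).
Local Notation P := (prod_topology (fun _ : option W => R[i]^o : topologicalType)).
Implicit Types (a b c : W) (p q x y : P) (D : W -> @stage_data R d W).
Variable guess : W -> set P.
Local Notation regular := (regular HW guess).
Local Notation regular_at := (regular_at HW guess).
Local Notation guessed := (guessed guess).
Local Notation sec := (sec HW).

(** The function is [Phi \o h] with [h] peaking at [x] only. The sets [Q k] collect the values of
    [h] over the guessed sets of the stages up to [a], numbered by [i]; they avoid 1 because [x]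
    lies over no guessed point. *)
Lemma regular_at_split D a x :
  (forall b, (b < a)%O -> regular_at D b (D b).1 (D b).2) ->
  tower (restr D a) x -> (forall c, (c <= a)%O -> ~ guessed D c (tr c x)) ->
  exists F, regular_at D a [set x] F.
Proof.
move=> rD tx nx; set D' := restr D a; pose K := tower D'.
have rD' : regular D' by exact: regular_restr.
have cK : compact K by exact: tower_compact rD'.
have [h [[ch hh] h1 h2]] := peak_point a rD' tx.
have hx : h x = 1 by exact: h1.
have hlt y : K y -> y <> x -> N (h y) < 1.
  move=> Ky yx; apply: h2 => // /=; rewrite (tower_restr_id Ky) (tower_restr_id tx) => /yx; exact.
have hne y : K y -> y <> x -> h y <> 1.
  by move=> Ky yx hy; have := hlt y Ky yx; rewrite hy modc1 ltxx.
have cl : countable [set c | (c <= a)%O] by exact: countable_le.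
have /countable_injP[i iinj] := cl.
pose Q k := [set w : C | exists c y, [/\ (c <= a)%O, i c = k,
  K y, guessed D c (tr c y) & w = h y]].
have cont1 : cont_on K (fun y => 1 + (-1) * h y).
  by apply: cont_onD; [exact: cont_on_cst|apply: cont_onM => //; exact: cont_on_cst].
have LU (e : R) : 0 < e -> exists2 r : R, 0 <= r < 1 &
    forall w, (h @` K) w -> e <= N (1 - w) -> N w <= r.
  move=> e0; have [y Ky|r r01 hr] := compact_strict_bound (c := e) cK cont1 ch.
    rewrite mulN1r => hy; apply: hlt => // yx; move: hy.
    by rewrite yx hx subrr modc0 leNgt e0.
  by exists r => // _ [y Ky <-] hy; apply: hr => //; rewrite mulN1r.
have QL k : Q k `<=` (h @` K) `\ 1.
  move=> _ [c [y [ca _ Ky gy ->]]]; split; first by exists y.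
  by apply: hne => // yx; apply: (nx c ca); rewrite -yx.
have L1 : (h @` K) 1 by exists x.
have hnear (e : R) : 0 < e -> \forall y \near x, K y -> N (1 - h y) < e.
  by move=> e0; have := ch x tx e e0; rewrite hx; apply: filterS => y + Ky; rewrite modc_distC; apply.
have [p [Phi [Phi1 pB pcv [Phic Phil] Phisw]]] := sweeping_function L1 LU QL.
exists (Phi \o h); split.
- by move=> _ ->; split=> // x' ->.
- move=> y Ky /= yx e e0; have hy : h y != 1 by apply/eqP; exact: hne.
  have Lh : (h @` K) (h y) by exists y.
  have [dl dl0 hdl] := Phic _ e Lh hy e0.
  have m0 : 0 < Num.min dl (N (1 - h y)).
    by rewrite lt_min dl0 modc_gt0 subr_eq0 eq_sym.
  apply: filterS (ch y Ky _ m0) => y' + Ky' => /(_ Ky'); rewrite lt_min => /andP[c1 c2].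
  split; last by apply: hdl => //; exists y'.
  by move=> yx'; move: c2; rewrite yx' hx ltxx.
- move=> _ c -> ca clx s e U sI e0 xU.
  (* Closeness at stage [c] lifts to closeness at stage [a] by [closure_lift], so [Q (i c)]
     accumulates at 1. *)
  have act (dl : R) : 0 < dl -> exists2 w, Q (i c) w & N (1 - w) < dl.
    move=> dl0; have [|y [Ky Uy gy]] := closure_lift rD' tx (c := c) _ (hnear _ dl0).
      by rewrite guessed_restr.
    exists (h y); last exact: Uy.
    by exists c, y; split=> //; move: gy; rewrite guessed_restr.
  have [dl dl0 hdl] := compact_peak_nbhs cK ch hne xU.
  have [_ [[c' [y [c'a ic Ky gy ->]]] w1 ws]] := Phisw _ act s e dl sI e0 dl0.
  have cc : c' = c by apply: iinj => //; exact/mem_set.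
  by exists y; split=> //; [exact: hdl|rewrite -cc].
- move=> _ -> e e0; have [dl dl0 hdl] := Phil e e0.
  apply: filterS (hnear dl dl0) => y hy Ky yx; apply: hdl (hy Ky).
    by exists y.
  by apply/eqP; exact: hne.
- apply: (@BLC_lim R (fun k t => (p k).[h (sec D' t)]) _ 5).
  + by move=> k; have [] : analytic HW D' (fun z => (p k).[h z]) by exact: analytic_poly.
  + by move=> k t; apply: pB; exists (sec D' t) => //; exact: sec_tower.
  + by move=> t; apply: pcv; exists (sec D' t) => //; exact: sec_tower.
- move=> y Ky; have Lh : (h @` K) (h y) by exists y.
  rewrite -[_ y]subr0; apply: cvgc_le (pcv _ Lh) _.
  by exists 0%N => n _; rewrite subr0; exact: pB.
- by move=> _ ->; rewrite /= hx.
Qed.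

Definition candidate D a x := [/\ tower (restr D a) x, closure (guessed D a) x &
  forall c, (c <= a)%O -> ~ guessed D c (tr c x)].

(** A candidate is split when there is one, and otherwise the stage is trivial. Beyond regularity it
    is only recorded that some split point lies in the closure of the guessed set. *)
Lemma tower_exists : exists D, regular D /\
  forall a, (exists x, candidate D a x) ->
    exists2 x, (D a).1 x & closure (guessed D a) x.
Proof.
have [||D DP] := omega1_rec HW ((set0, fun=> 0) : @stage_data R d W) (G := fun a f t =>
  regular_at f a t.1 t.2 /\
  ((exists x, candidate f a x) -> exists2 x, t.1 x & closure (guessed f a) x)).
- move=> a f g t fg [h1 h2]; have fga : restr f a = restr g a by exact: restr_eq.
  have gfg c : (c <= a)%O -> guessed f c = guessed g c.
    by move=> ca; rewrite -(guessed_restr guess f ca) fga guessed_restr.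
  split; first exact: regular_at_congr h1.
  move=> [x [x1 x2 x3]]; rewrite -gfg//; apply: h2; exists x; split.
  + by rewrite fga.
  + by rewrite gfg.
  + by move=> c ca; rewrite gfg//; exact: x3.
- move=> a f IH; have [[x [x1 x2 x3]]|nx] := pselect (exists x, candidate f a x).
    have [|F rF] := regular_at_split _ x1 x3; first by move=> b /IH[].
    by exists ([set x], F); split=> // _; exists x.
  by exists (set0, fun=> 0); split; [exact: regular_at_trivial|move=> /nx].
by exists D; split=> [b|a]; [case: (DP b)|case: (DP a)].
Qed.

End Construction.

(** * Boxes, a category argument, and compactness of pairs *)

Section Boxes.
Context {R : realType} (I : choiceType).
Local Notation C := R[i].
Local Notation N := (@modc R).
Local Notation P := (prod_topology (fun _ : I => R[i]^o : topologicalType)).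

Lemma closed_box (s : seq I) (z : I -> C) (r : R) :
  closed [set q : P | forall i, i \in s -> N (q i - z i) <= r].
Proof.
move=> p clp i si; apply/ler_addgt0Pr => e e0.
have [q [/(_ i si) h /= pq]] := clp _ (nbhs_coord p i e0).
have := modc_dist_triangle (q i) (p i) (z i); rewrite (modc_distC (p i) (q i)); lra.
Qed.

Lemma nbhs_closed (p : P) U : nbhs p U -> exists V, [/\ nbhs p V, closed V & V `<=` U].
Proof.
move=> /nbhs_boxP[s [e [e0 h]]].
exists [set q : P | forall i, i \in s -> N (q i - p i) <= e / 2]; split.
- apply/nbhs_boxP; exists s, (e / 2); split; first by lra.
  by move=> q hq i /hq/ltW.
- exact: closed_box.
- by move=> q hq; apply: h => i /hq; lra.
Qed.

Lemma nbhs_neq (p q : P) : p <> q -> nbhs p [set r : P | r <> q].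
Proof.
move=> pq; have [i pqi] : exists i, p i <> q i.
  by apply: contrapT => ne; apply: pq; apply/funext => i; apply: contrapT => h; apply: ne; exists i.
have e0 : 0 < N (q i - p i) by rewrite modc_gt0 subr_eq0; apply/eqP => /esym.
by apply: filterS (nbhs_coord p i e0) => r /= + rq; rewrite rq ltxx.
Qed.

(* Baire category inside the compact closure of [S]. *)
Lemma dense_in_itself_avoid (S B : set P) :
  S !=set0 -> compact (closure S) -> countable B ->
  (forall s U, S s -> nbhs s U -> exists2 s', S s' & U s' /\ s' <> s) ->
  exists2 x, closure S x & ~ B x.
Proof.
move=> [s0 Ss0] cS /countable_injP[i iinj] dS.
pose J (n : nat) (x : P * set P) := [/\ S x.1, nbhs x.1 x.2 & closed x.2].
pose K (n : nat) (x y : P * set P) := y.2 `<=` x.2 /\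
  forall b, B b -> i b = n -> ~ y.2 b.
have [||f fP] := @dependent_choice_rel _ J K.
- by exists (s0, setT); split; [|exact: filterT|exact: closedT].
- move=> n [s U] [/= Ss sU cU].
  suff [s' [Ss' s'U nb]] : exists s', [/\ S s', nbhs s' U & forall b, B b -> i b = n -> s' <> b].
    have [[b [Bb ib]]|nb'] := pselect (exists b, B b /\ i b = n).
      have [V [s'V cV VU]] := nbhs_closed (filterI s'U (nbhs_neq (nb b Bb ib))).
      exists (s', V); split; [split=> /=|by []]; first by move=> q /VU[].
      move=> c Bc ic Vc; have [_] := VU _ Vc; apply; apply: iinj; rewrite ?ib//; exact/mem_set.
    have [V [s'V cV VU]] := nbhs_closed s'U.
    by exists (s', V); split; [split=> //= b Bb ib; case: nb'; exists b|].
  have [[b [Bb ib]]|nb] := pselect (exists b, B b /\ i b = n); last first.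
    by exists s; split=> // b Bb ib; case: nb; exists b.
  have uniq c : B c -> i c = n -> c = b.
    by move=> Bc ic; apply: iinj; rewrite ?ib//; exact/mem_set.
  have [sb|sb] := pselect (s = b); last first.
    by exists s; split=> // c Bc ic; rewrite (uniq c).
  have [s' Ss' [s'U s's]] := dS _ _ Ss (nbhs_interior sU).
  by exists s'; split=> // c Bc ic; rewrite (uniq c)// -sb.
have mono m n : (m <= n)%N -> (f n).2 `<=` (f m).2.
  move=> /subnK <-; elim: (n - m)%N => // k IH; rewrite addSn.
  by apply: subset_trans IH; have [_ []] := fP (k + m)%N.
pose s n := (f n).1.
have fS n : closure S (s n) by have [[Ss _ _] _] := fP n; exact: subset_closure.
have [x [xS xcl]] := cS (s @ \oo) _ (filterS (fun n _ => fS n) filterT).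
have xf m : (f m).2 x.
  have [[_ _ cV] _] := fP m; apply: cV => U /(xcl (f m).2); apply.
  exists m => // n /= mn; apply: (mono _ _ mn); have [[_ h _] _] := fP n.
  exact: nbhs_singleton h.
by exists x => // Bx; have [_ [_ /(_ x Bx erefl)]] := fP (i x); apply; exact: xf.
Qed.

End Boxes.

Section PairCompactness.
Context {R : realType} {I : choiceType} {T : Type}.
Local Notation N := (@modc R).
Local Notation P := (prod_topology (fun _ : I => R[i]^o : topologicalType)).

(** As the [V d] are nested, the sets of pairs agreeing on them form a filter base, and a cluster
    point in the compact product agrees on all of them. This is the limit step of
    [fibre_inseparable]. *)
Lemma compact_common_agreement (A1 A2 : set P) (J : set T) (V : T -> set I) :
  compact A1 -> compact A2 -> J !=set0 ->
  (forall d d', J d -> J d' -> V d `<=` V d' \/ V d' `<=` V d) ->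
  (forall d, J d -> exists p q, [/\ A1 p, A2 q & forall i, V d i -> p i = q i]) ->
  exists p q, [/\ A1 p, A2 q & forall d i, J d -> V d i -> p i = q i].
Proof.
move=> c1 c2 [d0 Jd0] tot ex.
pose Z d := [set pq : P * P | [/\ A1 pq.1, A2 pq.2 & forall i, V d i -> pq.1 i = pq.2 i]].
have FF : ProperFilter (filter_from J Z).
  apply: filter_from_proper; last by move=> d /ex[p [q ?]]; exists (p, q).
  apply: filter_from_filter; first by exists d0.
  move=> d d' Jd Jd'; case: (tot d d' Jd Jd') => h; [exists d'|exists d] => // -[p q] [/= h1 h2 h3];
    by split; split=> //= i Vi; apply: h3; try exact: h.
have [|[p q] [[/= A1p A2q] cl]] := compact_setX c1 c2 (F := filter_from J Z) _.
  by exists d0 => // -[p q] [].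
exists p, q; split=> // d i Jd Vi; apply/eqP; rewrite -subr_eq0 -modc_eq0 eq_le modc_ge0 andbT.
apply/ler_addgt0Pr => e e0; rewrite add0r; have e2 : 0 < e / 2 by lra.
have Zd : filter_from J Z (Z d) by exists d.
have nb : nbhs (p, q) [set pq : P * P | N (pq.1 i - p i) < e / 2 /\ N (pq.2 i - q i) < e / 2].
  by exists ([set r : P | N (r i - p i) < e / 2], [set r : P | N (r i - q i) < e / 2]);
    [split; exact: nbhs_coord|move=> [r r'] []].
have [[r r'] [[/= _ _ rr'] [h1 h2]]] := cl _ _ Zd nb.
move: h2; rewrite -rr'// => h2.
have := modc_dist_triangle (r i) (p i) (q i); rewrite (modc_distC (p i) (r i)); lra.
Qed.

End PairCompactness.

(** * Separability *)

Section RationalBoxes.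
Context {R : realType}.
Local Notation C := R[i].
Local Notation N := (@modc R).

(** Diamond guesses sets, so a complex coordinate is encoded by the rational cuts of its real and
    imaginary parts. *)
Definition dedekind_code (z : C) : set (bool * rat) :=
  [set t | ratr t.2 < (if t.1 then complex.Re z else complex.Im z)].

Lemma dedekind_code_inj (z w : C) :
  (forall t, dedekind_code z t <-> dedekind_code w t) -> z = w.
Proof.
have lt (x y : R) : (forall t : rat, ratr t < x <-> ratr t < y) -> x = y.
  move=> h; apply/eqP; rewrite eq_le !leNgt; apply/andP; split; apply/negP => xy.
    have [q] := rat_in_itvoo xy; rewrite in_itv/= => /andP[q1 q2].
    by have := (h q).1 q2; rewrite ltNge (ltW q1).
  have [q] := rat_in_itvoo xy; rewrite in_itv/= => /andP[q1 q2].
  by have := (h q).2 q2; rewrite ltNge (ltW q1).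
case: z w => a b [a' b'] h; congr Complex.
  by apply: lt => t; exact: (h (true, t)).
by apply: lt => t; exact: (h (false, t)).
Qed.

Definition rat_complex (z : rat * rat) : C := (ratr z.1 +i* ratr z.2)%C.

Lemma rat_complex_dense (z : C) (e : R) : 0 < e -> exists q, N (z - rat_complex q) < e.
Proof.
move=> e0; have near (x : R) : exists q : rat, `|x - ratr q| < e / 2.
  have xe : x < x + e / 2 by lra.
  have [q] := rat_in_itvoo xe.
  rewrite in_itv/= => /andP[q1 q2]; exists q; rewrite ltr_norml; lra.
case: z => a b; have [q1 h1] := near a; have [q2 h2] := near b.
exists (q1, q2); apply: le_lt_trans (modc_le_ReIm _) _; rewrite !raddfB/=; lra.
Qed.

End RationalBoxes.

Section Separability.
Context {R : realType} {d : Order.disp_t} {W : orderType d}.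
Hypothesis HW : is_omega1 W.
Local Notation N := (@modc R).
Local Notation P := (prod_topology (fun _ : option W => R[i]^o : topologicalType)).
Implicit Types (a b c : W) (p q x y : P) (D : W -> @stage_data R d W).

Definition below a (i : option W) : bool := if i is Some b then (b < a)%O else true.

Lemma tr_eqP a p q : tr a p = tr a q <-> forall i, below a i -> p i = q i.
Proof.
split=> [pq [b|_]|h]; first exact: tr_eq_lt pq.
  exact: tr_eq_None pq.
by apply: tr_eq => [|b]; [exact: (h None)|exact: (h (Some b))].
Qed.

Definition box_code := (seq (option W * (rat * rat)) * rat)%type.

Definition rational_box (s : box_code) : set P :=
  [set p | forall t, t \in s.1 -> N (p t.1 - rat_complex t.2) <= ratr s.2].

Lemma rational_box_closed s : closed (rational_box s).
Proof.
move=> p clp t ts; apply/ler_addgt0Pr => e e0.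
have [q [/(_ t ts) h /= pq]] := clp _ (nbhs_coord p t.1 e0).
have := modc_dist_triangle (q t.1) (p t.1) (rat_complex t.2).
by rewrite (modc_distC (p t.1) (q t.1)); lra.
Qed.

Lemma rational_box_near (s : seq (option W)) (e : R) p : 0 < e -> exists b : box_code,
  [/\ forall t, t \in b.1 -> t.1 \in s, rational_box b p &
      forall q, rational_box b q -> forall i, i \in s -> N (q i - p i) < e].
Proof.
move=> e0; have e20 : 0 < e / 2 by lra.
have [r] := rat_in_itvoo e20.
rewrite in_itv/= => /andP[r0 re].
have /choice[z zP] (i : option W) := rat_complex_dense (p i) r0.
exists ([seq (i, z i) | i <- s], r); split.
- by move=> t /mapP[i si ->].
- by move=> t /mapP[i si ->]; exact/ltW/zP.
- move=> q qb i si; have := qb (i, z i) (map_f _ si); have := zP i.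
  have := modc_dist_triangle (rat_complex (z i)) (q i) (p i).
  rewrite (modc_distC (rat_complex (z i))) /=; lra.
Qed.

Definition code_below a : set box_code := [set b : box_code | forall t, t \in b.1 -> below a t.1].

Lemma code_below_countable a : countable (code_below a).
Proof.
have /countable_injP[i iinj] : countable (initial_segment a) by have [_ _] := HW.
pose j (o : option W) : option nat := omap i o.
have jinj o o' : below a o -> below a o' -> j o = j o' -> o = o'.
  by case: o o' => [b|] [b'|] //= ba b'a [/iinj ->] //; exact/mem_set.
apply/countable_injP.
exists (fun b : box_code => pickle ([seq (j t.1, t.2) | t <- b.1], b.2)).
move=> [s r] [s' r'] /set_mem/= sa /set_mem/= s'a.
move=> /(pcan_inj (@pickleK _)) /= [ss ->]; congr (_, _).
elim: s s' ss sa s'a => [|[k z] s IH] [|[k' z'] s'] //= [kk -> ss] sa s'a.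
congr ((_, _) :: _).
  by apply: jinj kk; [apply: (sa (k, z'))|apply: (s'a (k', z'))]; rewrite /= inE eqxx.
by apply: IH => // t ts; [apply: sa|apply: s'a]; rewrite inE ts orbT.
Qed.

Lemma nbhs_tr_box a p U : nbhs (tr a p) U -> exists b : box_code,
  [/\ code_below a b, rational_box b p & forall q, rational_box b q -> U (tr a q)].
Proof.
move=> /nbhs_boxP[s [e [e0 sU]]].
have [b [b1 b2 b3]] := rational_box_near [seq i <- s | below a i] p e0.
exists b; split=> // [t /b1|q qb]; first by rewrite mem_filter => /andP[].
apply: sU => i si; have [ai|nai] := boolP (below a i).
  have := b3 q qb i; rewrite mem_filter ai si => /(_ isT).
  by case: i ai {si} => [c|_ //] ca; rewrite (tr_lt q ca) (tr_lt p ca).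
case: i nai {si} => // c; rewrite /below -leNgt => ac.
by rewrite (tr_ge q ac) (tr_ge p ac) subrr modc0.
Qed.

(** A sequence of points is coded by triples of index, coordinate and cut. For a limit [a], the
    triples of rank below [a] describe the coordinates below [a] of the terms before [a]. *)
Definition coord_rank (t : W * option W * (bool * rat)) : W :=
  if t.1.2 is Some b then Order.max t.1.1 b else t.1.1.

Lemma coord_rank_countable a : countable [set t | (coord_rank t <= a)%O].
Proof.
have cle := countable_le HW a.
have csome : countable (None |` (Some @` [set b | (b <= a)%O])).
  by apply: countableU (@countable1 _ _) _; exact: countable_image.
apply: sub_countable (countableX (countableX cle csome) (countableP [set: bool * rat])).
apply: subset_card_le => -[[xi [b|]] u]; rewrite /coord_rank/=.
  by rewrite ge_max => /andP[h1 h2]; split=> //; split=> //; right; exists b.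
by move=> h; split=> //; split=> //; left.
Qed.

Variable dia : W -> set W.
Hypothesis diaP : diamond_sequence dia.

Definition coord_guess : W -> set (W * option W * (bool * rat)) :=
  projT1 (cid (diamond_guess HW coord_rank_countable diaP)).

(** Coordinates from [c] on are left free here; in [guessed] the intersection with the stage makes
    them 0, so each index [xi] names at most one point. *)
Definition guess c : set P := [set q | exists2 xi, (xi < c)%O &
  forall i, below c i -> forall u, dedekind_code (q i) u <-> coord_guess c (xi, i, u)].

Local Notation guessed := (@guessed R d W guess).
Local Notation regular := (@regular R d W HW guess).

Lemma guessed_countable D c : countable (guessed D c).
Proof.
pose F xi := guessed D c `&` [set q : P |
  forall i, below c i -> forall u, dedekind_code (q i) u <-> coord_guess c (xi, i, u)].
have ci : countable (initial_segment c) by have [_ _] := HW.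
have cF xi : initial_segment c xi -> countable (F xi).
  move=> _; have [[p0 Fp0]|nF] := pselect (F xi !=set0).
    rewrite (_ : F xi = [set p0]); first exact: countable1.
    apply/seteqP; split=> [q [[tq _] hq]|_ ->//]; have [[tp _] hp] := Fp0.
    rewrite /= -(tower_restr_id tq) -(tower_restr_id tp); apply/tr_eqP => i ic.
    by apply: dedekind_code_inj => u; rewrite hq// hp.
  rewrite (_ : F xi = set0); first exact: countable0.
  by apply/seteqP; split=> // q Fq; case: nF; exists q.
rewrite (_ : guessed D c = \bigcup_(xi in initial_segment c) F xi).
  exact: countable_bigcup_countable.
apply/seteqP; split=> [q [tq [xi xic h]]|q [xi xic []//]].
by exists xi => //; split=> //; split=> //; exists xi.
Qed.

Lemma guess_sequence D (e : W -> P) (g : W -> W) a0 : (forall xi, tower D (e xi)) ->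
  exists a, [/\ (a0 < a)%O, forall b, (b < a)%O -> (g b < a)%O &
    guessed D a = [set tr a (e xi) | xi in initial_segment a]].
Proof.
move=> te; have := projT2 (cid (diamond_guess HW coord_rank_countable diaP)).
rewrite -/coord_guess => /(_ [set t | dedekind_code (e t.1.1 t.1.2) t.2] g a0).
move=> [a [a0a ga ha]]; exists a; split=> //.
have rk xi i u : (xi < a)%O -> below a i -> (coord_rank (xi, i, u) < a)%O.
  by case: i => [b|] //= xia ba; rewrite /coord_rank/= gt_max xia.
apply/seteqP; split=> [q [tq [xi xia h]]|_ [xi xia <-]].
  exists xi => //; rewrite -[RHS](tower_restr_id tq); apply/tr_eqP => i ia.
  apply: dedekind_code_inj => u; rewrite h//; symmetry.
  exact: (ha (xi, i, u) (rk _ _ _ xia ia)).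
split; first exact: tower_tr.
exists xi => // i ia u; have [_ E] := tr_eqP a (tr a (e xi)) (e xi).
have -> : tr a (e xi) i = e xi i by have /tr_eqP := tr_trl (e xi) (lexx a); apply.
by symmetry; exact: (ha (xi, i, u) (rk _ _ _ xia ia)).
Qed.

(** [closure_lift] finds points of the tower near [p] over the guessed set, and by [unique_lift]
    these are elements of [F] itself. *)
Lemma guessed_closure D (F : set P) a p : regular D -> F `<=` tower D ->
  guessed D a = tr a @` F -> tower D p -> closure (tr a @` F) (tr a p) -> closure F p.
Proof.
move=> rD FD gF tp clp U pU.
have [|q [tq Uq gq]] := closure_lift rD tp (c := a) _ pU; first by rewrite gF.
have [f Ff fq] : (tr a @` F) (tr a q) by rewrite -gF.
exists q; split=> //; rewrite -(unique_lift rD (FD f Ff) tq fq)//.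
by rewrite fq.
Qed.

(* Otherwise there is a left-separated sequence [e]; at a closed stage [a] where its initial segment is guessed, [e a] lies in the closure of the earlier terms. *)
Lemma tower_hereditarily_separable D (E : set P) : regular D -> E `<=` tower D ->
  exists F, [/\ countable F, F `<=` E & E `<=` closure F].
Proof.
move=> rD ED; apply: contrapT => nsep.
have [p0 _] : exists p : P, True by exists (fun=> 0).
have [||e eP] := omega1_rec HW p0 (G := fun a f x =>
    E x /\ ~ closure (f @` initial_segment a) x).
- move=> a f g x fg [Ex h]; split=> //.
  rewrite (_ : g @` _ = f @` initial_segment a)//.
  by apply/seteqP; split=> _ [b ba <-]; exists b => //; rewrite fg.
- move=> a f IH; apply: contrapT => nx; apply: nsep.
  exists (f @` initial_segment a); split.
  + by apply: countable_image; have [_ _] := HW.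
  + by move=> _ [b /IH[Eb _] <-].
  + by move=> x Ex; apply: contrapT => h; apply: nx; exists x.
have te xi : tower D (e xi) by apply: ED; have [] := eP xi.
(* [xi s] is a canonical index whose term is in the box [s], provided any term is. *)
have /choice[xi xiP] (s : box_code) : exists b, forall c, rational_box s (e c) -> rational_box s (e b).
  have [[b hb]|nb] := pselect (exists b, rational_box s (e b)); first by exists b.
  have [b _] := countable_bounded HW (@countable0 W).
  by exists b => c hc; case: nb; exists c.
have /choice[g gP] (b : W) : exists b', forall s, code_below b s -> (xi s < b')%O.
  have [b' h] := countable_bounded HW (countable_image xi (code_below_countable b)).
  by exists b' => s sb; apply: h; exists s.
have /choice[sc scP] (b : W) : exists b', (b < b')%O.
  by have [b' ? _] := omega1_succ HW b; exists b'.
have [a0 _] := countable_bounded HW (@countable0 W).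
(* Closure under [sc] makes [a] a limit, so the finitely many coordinates of a code below [a] are
   below some [b < a]; closure under [g] then gives [xi s < a]. So each box around [tr a (e a)] with
   coordinates below [a] contains an earlier term. *)
have [a [a0a ga gE]] := guess_sequence (fun b => Order.max (g b) (sc b)) a0 te.
have [_ ncl] := eP a; apply: ncl.
apply: (guessed_closure rD (F := e @` initial_segment a) (a := a)) => //.
- by move=> _ [b _ <-].
- by rewrite gE image_comp.
move=> U aU; have [s [sa s1 s2]] := nbhs_tr_box aU.
have [b ba sb] : exists2 b, (b < a)%O & code_below b s.
  have [b h] : exists b, (b < a)%O /\ forall i, i \in [seq t.1 | t <- s.1] -> below b i.
    have {}sa t : t \in s.1 -> below a t.1 by exact: sa.
    elim: {s1 s2} s.1 sa => [|[[c|] z] l IH] sa; first by exists a0.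
      have [|b [ba hb]] := IH; first by move=> t tl; apply: sa; rewrite inE tl orbT.
      have ca : (c < a)%O by apply: (sa (Some c, z)); exact: mem_head.
      have := ga (Order.max b c); rewrite !gt_max ba ca => /(_ isT)/andP[_ sca].
      exists (sc (Order.max b c)); split=> // i.
      have := scP (Order.max b c); rewrite gt_max => /andP[b1 b2].
      rewrite inE => /orP[/eqP->//|/hb]; case: i => //= i'; by move=> /lt_trans; apply.
    have [|b [ba hb]] := IH; first by move=> t tl; apply: sa; rewrite inE tl orbT.
    by exists b; split=> // i; rewrite inE => /orP[/eqP->|/hb].
  by exists b; [case: h|move=> t ts; case: h => _; apply; exact: map_f].
have xia : (xi s < a)%O.
  by apply: lt_trans (gP b s sb) _; have := ga b ba; rewrite gt_max => /andP[].
exists (tr a (e (xi s))); split; first by exists (e (xi s)) => //; exists (xi s).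
by apply: s2; exact: xiP s1.
Qed.

(** A countable set is guessed through a sequence in which its elements occupy positions [u (j f)],
    all below a fixed [b], and every other position holds some element of [F]. Beyond [b] each
    initial segment lists all of [F]. *)
Lemma guess_countable D (F : set P) a0 : countable F -> F !=set0 -> F `<=` tower D ->
  exists a, (a0 < a)%O /\ guessed D a = tr a @` F.
Proof.
move=> /countable_injP[j jinj] [f0 Ff0] FD.
have [u [uinj _]] := omega1_increasing HW a0.
have /choice[e eP] (xi : W) : exists f, F f /\ forall f', F f' -> u (j f') = xi -> f = f'.
  have [[f [Ff uf]]|nf] := pselect (exists f, F f /\ u (j f) = xi).
    exists f; split=> // f' Ff' uf'; apply: jinj; try exact/mem_set.
    by apply: uinj; rewrite uf.
  by exists f0; split=> // f' Ff' uf'; case: nf; exists f'.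
have [b hb] := countable_bounded HW (countable_image u (countableP setT)).
have te xi : tower D (e xi) by apply: FD; have [] := eP xi.
have [a [ba _ gE]] := guess_sequence id (Order.max a0 b) te.
move: ba; rewrite gt_max => /andP[a0a ba].
exists a; split=> //; rewrite gE; apply/seteqP; split=> _ [x xa <-].
  by exists (e x) => //; have [] := eP x.
have ua : (u (j x) < a)%O by apply: lt_trans ba; apply: hb; exists (j x).
exists (u (j x)) => //; congr (tr a _); have [_] := eP (u (j x)); exact.
Qed.

(** A countable dense subset of [K] is guessed at some [a]. By [guessed_closure] a point off [K] is
    then separated from [K] by coordinates below [a], and rational boxes on those are countably
    many. *)
Lemma tower_open_sigma_compact D (K : set P) : regular D -> K `<=` tower D -> closed K ->
  exists BB : set (set P), [/\ countable BB, forall B, BB B -> compact B &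
    tower D `\` K = \bigcup_(B in BB) B].
Proof.
move=> rD KD cK; have cD := tower_compact rD.
have [[k0 Kk0]|nK] := pselect (K !=set0); last first.
  exists [set tower D]; split; [exact: countable1|by move=> _ ->|].
  rewrite bigcup_set1; apply/seteqP; split=> [x []//|x tx]; split=> // Kx.
  by apply: nK; exists x.
have [F [cF FK KF]] := tower_hereditarily_separable rD KD.
have F0 : F !=set0 by have [f [Ff _]] := KF _ Kk0 _ filterT; exists f.
have FD : F `<=` tower D by exact: subset_trans FK KD.
have [a0 _] := countable_bounded HW (@countable0 W).
have [a [_ gE]] := guess_countable a0 cF F0 FD.
exists [set tower D `&` rational_box s | s in [set s | code_below a s /\
  tower D `&` rational_box s `&` K = set0]]; split.
- apply: countable_image; apply: sub_countable (code_below_countable a).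
  by apply: subset_card_le => s [].
- by move=> _ [s _ <-]; apply: compact_closedI => //; exact: rational_box_closed.
apply/seteqP; split=> [p [tp nKp]|p [_ [s [sa sK] <-] [tp sp]]]; last first.
  split=> // Kp; have : (tower D `&` rational_box s `&` K) p by [].
  by rewrite sK.
have ncl : ~ closure (tr a @` F) (tr a p).
  move=> /(guessed_closure rD FD gE tp) clp; apply: nKp.
  rewrite (iffLR (closure_id K) cK); exact: closureS clp.
have [U pU UF] : exists2 U, nbhs (tr a p) U & forall f, F f -> ~ U (tr a f).
  apply: contrapT => nU; apply: ncl => U pU; apply: contrapT => ne; apply: nU.
  by exists U => // f Ff Uf; apply: ne; exists (tr a f); split=> //; exists f.
move: pU => /nbhs_boxP[s [e [e0 sU]]]; have e2 : 0 < e / 2 by lra.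
have [b [b1 b2 b3]] := rational_box_near [seq i <- s | below a i] p e2.
exists (tower D `&` rational_box b) => //; exists b => //; split.
  by move=> t /b1; rewrite mem_filter => /andP[].
apply/seteqP; split=> // k [[tk bk] Kk].
have kU : nbhs k [set f : P | forall i, i \in s -> N (f i - k i) < e / 2].
  by apply/nbhs_boxP; exists s, (e / 2).
have [f [Ff fk]] := KF k Kk _ kU; apply: (UF f Ff); apply: sU => i si.
have [ai|nai] := boolP (below a i); last first.
  case: i nai {si} => // c; rewrite /below -leNgt => ac.
  by rewrite (tr_ge f ac) (tr_ge p ac) subrr modc0.
have h1 : N (k i - p i) < e / 2 by apply: (b3 k bk i); rewrite mem_filter ai.
have h2 := fk i si.
have := modc_dist_triangle (k i) (f i) (p i).
by case: i ai h1 h2 {si} => [c|] ca h1 h2; rewrite ?(tr_lt f ca) ?(tr_lt p ca) ?tr_None; lra.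
Qed.

End Separability.

(** * Fibres *)

Section Fibres.
Context {R : realType} {d : Order.disp_t} {W : orderType d}.
Hypothesis HW : is_omega1 W.
Local Notation C := R[i].
Local Notation P := (prod_topology (fun _ : option W => R[i]^o : topologicalType)).
Implicit Types (a b c : W) (p q x y : P) (D : W -> @stage_data R d W).

Lemma fibre_point D a x s : tower (restr D a) x -> (D a).1 x -> unit_interval s ->
  exists q, [/\ tower D q, tr a q = x & q (Some a) = s].
Proof.
move=> tx Sx sI; have [b ab bmin] := omega1_succ HW a.
pose y : P := fun i => if i == Some a then s else x i.
have ya : y (Some a) = s by rewrite /y eqxx.
have yx c : c != a -> y (Some c) = x (Some c).
  by move=> ca; rewrite /y; case: eqP => // -[] /eqP; rewrite (negbTE ca).
have try c : (c <= a)%O -> tr c y = tr c x.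
  move=> ca; apply: tr_eq => // c' c'c; apply: yx.
  by rewrite lt_eqF//; exact: lt_le_trans ca.
have ty : tower (restr D b) y.
  split; first exact: tx.1.
  move=> c; have [cb|bc] := ltP c b; last first.
    right; rewrite restr_ge//=; have ac : (a < c)%O by exact: lt_le_trans ab bc.
    by rewrite yx ?gt_eqF// (tower_restr_ge tx)// ltW.
  rewrite /step_ok restr_lt//.
  have ca : (c <= a)%O by rewrite leNgt; apply/negP => /bmin; rewrite leNgt cb.
  rewrite try//; move: ca; rewrite le_eqVlt => /orP[/eqP ->|ca].
    by left; rewrite (tower_restr_id tx) ya.
  by have := tx.2 c; rewrite /step_ok restr_lt// yx// lt_eqF.
have [q [tq qy _]] := tower_extend HW ty; exists q; split=> //.
  by rewrite -(tr_trl q (ltW ab)) qy try// (tower_restr_id tx).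
by rewrite -ya -qy tr_lt.
Qed.

Variable guess : W -> set P.
Local Notation regular := (regular HW guess).

Lemma tr_fibre_closed a x : closed [set p : P | tr a p = x].
Proof.
move=> p clp; apply/funext => i; apply/eqP; rewrite -subr_eq0 -modc_eq0 eq_le modc_ge0 andbT.
apply/ler_addgt0Pr => e e0; rewrite add0r.
by have [q [/= <- /ltW]] := clp _ (tr_nbhs (nbhs_coord (tr a p) i e0)); rewrite modc_distC.
Qed.

Lemma Re_coord_continuous i : continuous (fun p : P => complex.Re (p i)).
Proof.
move=> p A /nbhs_ballP[e /= e0 eA]; apply: filterS (nbhs_coord p i e0) => q /= h.
apply: eA; rewrite /ball/= distrC; apply: le_lt_trans h.
by apply: le_trans (normr_Re_le _); rewrite raddfB.
Qed.

(** If [tr c p] is split, the values at coordinate [c] of the points of [A1] and of [A2] over it are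
    two nonempty closed sets covering [0, 1], so they meet. If it is not split, the coordinate is
    determined. *)
Lemma fibre_step D (A1 A2 : set P) a x c : regular D ->
  compact A1 -> compact A2 -> A1 `|` A2 = tower D `&` [set p | tr a p = x] ->
  (a <= c)%O -> (exists p q, [/\ A1 p, A2 q & tr c p = tr c q]) ->
  exists p q, [/\ A1 p, A2 q & tr c p = tr c q /\ p (Some c) = q (Some c)].
Proof.
move=> rD c1 c2 A12 ac [p [q [A1p A2q pq]]].
have inD r : A1 r \/ A2 r -> tower D r /\ tr a r = x.
  by move=> h; have : (A1 `|` A2) r by []; rewrite A12.
have [tp px] := inD p (or_introl A1p); have [tq qx] := inD q (or_intror A2q).
have [_ _ _ _ _ _ h7] := rD c; set y := tr c p.
have [Sy|nSy] := pselect ((D c).1 y); last first.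
  exists p, q; split=> //; split=> //.
  case: (tp.2 c) => [[//]|->]; case: (tq.2 c) => [[]|->]; by rewrite -pq.
have inI r : tower D r -> tr c r = y -> unit_interval (r (Some c)).
  move=> tr' ry; case: (tr'.2 c) => [[]//|->].
  by rewrite ry h7//; exact: unit_interval0.
pose f (r : P) : R := complex.Re (r (Some c)).
have fI r : tower D r -> tr c r = y -> r (Some c) = (f r)%:C%C.
  by move=> tr' ry; have [] := inI r tr' ry; rewrite /f; case: (r (Some c)) => u v /= ->.
pose V A := f @` (A `&` [set r | tr c r = y]).
have Vcl A : compact A -> closed (V A).
  move=> cA; apply: compact_closed; first exact: Rhausdorff.
  apply: continuous_compact.
    by apply: continuous_subspaceT => r; exact: Re_coord_continuous.
  by apply: compact_closedI => //; exact: tr_fibre_closed.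
have V1 : V A1 (f p) by exists p.
have V2 : V A2 (f q) by exists q.
have VI A : (forall r, A r -> A1 r \/ A2 r) -> V A `<=` `[0, 1]%classic.
  move=> AA _ [r [Ar /= ry] <-]; have [tr' _] := inD r (AA r Ar).
  by have [_] := inI r tr' ry; rewrite in_itv.
have VU s : `[0, 1]%classic s -> V A1 s \/ V A2 s.
  rewrite /= in_itv/= => s01.
  have [r [tr' ry rs]] := fibre_point (tower_tr c tp) Sy (s := s%:C%C) (conj erefl s01).
  have : (A1 `|` A2) r.
    by rewrite A12; split=> //=; rewrite -(tr_trl r ac) ry /y tr_trl.
  by case=> Ar; [left|right]; exists r; rewrite /f ?rs.
have [s [s1 s2]] : V A1 `&` V A2 !=set0.
  apply: contrapT => V12.
  have E : V A1 = `[0, 1]%classic.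
    apply: (@segment_connected R 0 1); first by exists (f p).
      exists (~` V A2); first by rewrite openC; exact: Vcl.
      apply/seteqP; split=> [s Vs|s [/VU[]//]]; split.
      - by apply: (VI A1) Vs; left.
      - by move=> V2s; apply: V12; exists s.
    exists (V A1); first exact: Vcl.
    by apply/seteqP; split=> [s Vs|s []//]; split=> //; apply: (VI A1) Vs; left.
  by apply: V12; exists (f q); split=> //; rewrite E; apply: (VI A2) V2; right.
have [r1 [Ar1 /= r1y] e1] := s1; have [r2 [Ar2 /= r2y] e2] := s2.
exists r1, r2; split=> //; split; first by rewrite r1y r2y.
have [tr1 _] := inD r1 (or_introl Ar1); have [tr2 _] := inD r2 (or_intror Ar2).
by rewrite (fI r1)// (fI r2)// e1 e2.
Qed.

(* A separation of a fibre would persist at some least stage, where it splits a point or an interval. *)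
Lemma fibre_inseparable D (A1 A2 : set P) a x : regular D ->
  compact A1 -> compact A2 -> A1 !=set0 -> A2 !=set0 ->
  A1 `|` A2 = tower D `&` [set p | tr a p = x] -> A1 `&` A2 !=set0.
Proof.
move=> rD c1 c2 [p0 A1p0] [q0 A2q0] A12.
(* [V b] contains coordinate [b], unlike the coordinates kept by [tr b]: agreement on [V b] is what
   [fibre_step] yields at [b], and agreement on all [V c] with [c < b] is agreement under [tr b]. *)
pose V (b : W) : set (option W) := [set i | if i is Some c then (c <= b)%O else true].
have Vtot b b' : V b `<=` V b' \/ V b' `<=` V b.
  by case/orP: (le_total b b') => h; [left|right] => -[c|] //= cb; exact: le_trans h.
have VE b p q : (forall i, V b i -> p i = q i) <-> tr b p = tr b q /\ p (Some b) = q (Some b).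
  split=> [h|[pq pqb] [c|_]].
  - split; last by apply: h; rewrite /V/=.
    by apply: tr_eq => [|c cb]; apply: h => //=; exact: ltW.
  - by rewrite /V/= le_eqVlt => /orP[/eqP->//|]; exact: tr_eq_lt.
  - exact: tr_eq_None pq.
have init : tr a p0 = x /\ tr a q0 = x.
  have inx r : A1 r \/ A2 r -> tr a r = x.
    by move=> h; have : (A1 `|` A2) r by []; rewrite A12 => -[].
  by split; apply: inx; [left|right].
have agree b : (a <= b)%O -> exists p q, [/\ A1 p, A2 q & tr b p = tr b q].
  elim/(omega1_ind HW): b => b IH ab; have [<-|nab] := eqVneq a b.
    by exists p0, q0; split=> //; have [-> ->] := init.
  have {nab}ab : (a < b)%O by rewrite lt_neqAle nab.
  have J0 : [set c | (a <= c < b)%O] !=set0 by exists a; rewrite /= lexx.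
  have [|p [q [A1p A2q pq]]] := @compact_common_agreement R _ _ A1 A2 _ V
      c1 c2 J0 (fun c c' _ _ => Vtot c c').
    move=> c /andP[ac cb]; have [p [q [A1p A2q pq]]] := fibre_step rD c1 c2 A12 ac (IH c cb ac).
    by exists p, q; split=> //; apply/VE.
  exists p, q; split=> //; apply: tr_eq => [|c cb].
    by apply: (pq a) => //; rewrite /= lexx.
  by apply: (pq (Order.max a c)); rewrite /= ?gt_max ?le_max ?lexx ?ab ?cb ?orbT.
have J0 : [set c | (a <= c)%O] !=set0 by exists a; rewrite /= lexx.
have [|p [q [A1p A2q pq]]] := @compact_common_agreement R _ _ A1 A2 _ V
    c1 c2 J0 (fun c c' _ _ => Vtot c c').
  move=> c ac; have [p [q [A1p A2q pq]]] := fibre_step rD c1 c2 A12 ac (agree c ac).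
  by exists p, q; split=> //; apply/VE.
suff pE : p = q by exists p; split=> //; rewrite pE.
apply/funext => -[c|]; last by apply: (pq a) => //=; rewrite lexx.
by apply: (pq (Order.max a c)); rewrite /= ?le_max ?lexx ?orbT.
Qed.

End Fibres.

(** * Subspaces *)

Section SetTypeTopology.
Context {T : topologicalType} (K : set T).
Implicit Types (x y : set_type K) (U : set (set_type K)).

Lemma set_type_openP U : open U <-> exists2 V : set T, open V & val @^-1` V = U.
Proof. by []. Qed.

Lemma set_type_nbhsP x U : nbhs x U <->
  exists V : set T, nbhs (val x) V /\ forall y, V (val y) -> U y.
Proof.
split=> [|[V []]].
  rewrite (nbhsE x) => -[G [/set_type_openP[V oV <-] /= Vx] GU].
  exists V; split; first by apply: open_nbhs_nbhs.
  by move=> y Vy; exact: GU.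
rewrite (nbhsE (val x)) => -[G [oG Gx] GV] VU; rewrite nbhsE.
exists (val @^-1` G); first by split=> //; apply/set_type_openP; exists G.
by move=> y /= Gy; apply: VU; exact: GV.
Qed.

Lemma set_type_val_continuous : continuous (val : set_type K -> T).
Proof. by move=> x V Vx; apply/set_type_nbhsP; exists V. Qed.

Lemma set_type_compact : compact K -> compact [set: set_type K].
Proof.
move=> cK F FF _.
have FK : (val @ F) K.
  by apply: (@filterS _ F _ setT) filterT => x _; exact: set_valP.
have [p [Kp clp]] := cK (val @ F) (fmap_proper_filter val FF) FK.
exists (SigSub (mem_set Kp)); split=> // A B FA /set_type_nbhsP[V [/= Vp VB]].
have FA' : (val @ F) (val @` A) by apply: (@filterS _ F _ A) FA => x Ax; exists x.
have [_ [[x Ax <-] Vx]] := clp (val @` A) V FA' Vp.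
by exists x; split=> //; exact: VB.
Qed.

Lemma set_type_image_compact (B : set (set_type K)) :
  compact K -> closed B -> compact (val @` B).
Proof.
move=> cK clB; apply: continuous_compact.
  by apply: continuous_subspaceT => x; exact: set_type_val_continuous.
exact: (subclosed_compact clB (set_type_compact cK)).
Qed.

Lemma set_type_hausdorff : hausdorff_space T -> hausdorff_space (set_type K).
Proof.
move=> hT x y cl; apply: val_inj; apply: hT => A B Ax By.
have [|z [Az Bz]] := cl (val @^-1` A) (val @^-1` B) _ (set_type_val_continuous By).
  exact: (set_type_val_continuous Ax).
by exists (val z).
Qed.

End SetTypeTopology.

Section HereditaryProperties.
Context {T : topologicalType} (K : set T).

Lemma set_type_hereditarily_separable :
  (forall E : set T, E `<=` K -> exists F, [/\ countable F, F `<=` E & E `<=` closure F]) ->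
  hereditarily_separable (set_type K).
Proof.
move=> hs A; pose v (a : set_type A) : T := val (val a).
have vinj : injective v by move=> a b /val_inj/val_inj.
have [|F [cF FE EF]] := hs (range v); first by move=> _ [a _ <-]; exact: set_valP.
exists (v @^-1` F).
  have /countable_injP[i iinj] := cF; apply/countable_injP; exists (i \o v).
  by move=> a b /set_mem Fa /set_mem Fb /= /iinj; rewrite !inE => /(_ Fa Fb)/vinj.
move=> G [a Ga] /set_type_openP[V1 /set_type_openP[V oV <-] VO].
have aV : nbhs (v a) V.
  apply: open_nbhs_nbhs; split=> //; move: Ga; rewrite -VO; exact.
have rva : range v (v a) by exists a.
have [f [Ff Vf]] := EF (v a) rva V aV.
have [b _ bf] := FE f Ff.
have Vb : V (v b) by rewrite bf.
have Fb : F (v b) by rewrite bf.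
by exists b; split; [rewrite -VO|].
Qed.

(** With [G] the union of ambient open sets inducing the cover, [K] minus [G] is closed, so [K]
    meets [G] in countably many compact sets, each covered by countably many members. *)
Lemma set_type_hereditarily_lindelof : closed K ->
  (forall Z : set T, Z `<=` K -> closed Z -> exists BB : set (set T),
     [/\ countable BB, forall B, BB B -> compact B & K `\` Z = \bigcup_(B in BB) B]) ->
  hereditarily_lindelof (set_type K).
Proof.
move=> clK hl A U Uo Ucov; pose v (a : set_type A) : T := val (val a).
have /choice[V VP] (u : set (set_type A)) : exists V : set T, U u -> open V /\ v @^-1` V = u.
  have [/Uo/set_type_openP[V1 /set_type_openP[V oV <-] Vu]|nu] := pselect (U u); last by exists set0.
  by exists V.
pose G := \bigcup_(u in U) V u.
have oG : open G by apply: bigcup_open => u /VP[].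
have [|BB [cBB BBc BBE]] := hl (K `\` G) _ (closedI clK (open_closedC oG)); first by move=> x [].
have fin B : BB B -> exists U', [/\ U' `<=` U, countable U' & B `<=` \bigcup_(u in U') V u].
  move=> BB_B; have BO : B `<=` G.
    move=> x Bx; have : (K `\` (K `\` G)) x by rewrite BBE; exists B.
    by move=> [Kx nKO]; apply: contrapT => nOx; apply: nKO.
  (* A property is in this filter when it holds of every family containing some fixed countable
     subfamily of [U]. The covering form of compactness then returns a countable subfamily that
     covers [B]. *)
  pose F : set_system (set (set (set_type A))) := [set S | exists U',
    [/\ U' `<=` U, countable U' & forall U'', U' `<=` U'' -> S U'']].
  have FF : Filter F.
    split; first by exists set0; split=> //; exact: countable0.
      move=> S S' [U1 [U1U c1 h1]] [U2 [U2U c2 h2]]; exists (U1 `|` U2); split.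
      - by move=> u [/U1U|/U2U].
      - exact: countableU.
      - by move=> U'' h; split; [apply: h1|apply: h2] => u Uu; apply: h; [left|right].
    by move=> S S' SS' [U1 [U1U c1 h1]]; exists U1; split=> // U'' /h1/SS'.
  have /compact_near_coveringP/(_ _ F (fun U' x => exists2 u, U' u & V u x) FF) := BBc B BB_B.
  case=> [x /BO[u Uu Vx]|U' [U'U cU' /(_ U' (@subset_refl _ U')) h]].
    have [oV _] := VP u Uu.
    exists (V u, [set U' | U' u]); last by move=> [y U'] [/= Vy U'u]; exists u.
    split; first by apply: open_nbhs_nbhs.
    by exists [set u]; split=> [_ ->//||U'' h]; [exact: countable1|exact: h].
  by exists U'; split=> // x /h[u ? ?]; exists u.
have /choice[UU UUP] (B : set T) : exists U', BB B ->
    [/\ U' `<=` U, countable U' & B `<=` \bigcup_(u in U') V u].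
  by have [/fin[U' ?]|nB] := pselect (BB B); [exists U'|exists set0].
exists (\bigcup_(B in BB) UU B); split.
- by move=> u [B /UUP[h _ _] /h].
- by apply: countable_bigcup_countable => // B /UUP[].
apply/seteqP; split=> // a _.
have Ga : G (v a).
  have : (\bigcup_(V in U) V) a by rewrite Ucov.
  by move=> [u Uu ua]; exists u => //; have [_ E] := VP u Uu; move: ua; rewrite -{1}E.
have : (K `\` (K `\` G)) (v a) by split=> [|[]//]; exact: set_valP.
rewrite BBE => -[B BB_B Bx]; have [UUU _ /(_ _ Bx)[u UUu Vu]] := UUP B BB_B.
by exists u; [exists B|have [_ <-] := VP u (UUU u UUu)].
Qed.

End HereditaryProperties.

(* The union of the countable open sets is countable, and its complement has no isolated point. *)
Lemma scattered_lindelof_countable (X : topologicalType) :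
  scattered X -> hereditarily_lindelof X -> countable [set: X].
Proof.
move=> sX hX; pose U : set X := \bigcup_(G in [set G | open G /\ countable G]) G.
have cU : countable U.
  have [||U' [U'1 cU' U'2]] := hX U [set val @^-1` G | G in [set G : set X | open G /\ countable G]].
  - by move=> _ [G [oG _] <-]; apply/set_type_openP; exists G.
  - apply/seteqP; split=> // x _; have [G [oG cG] Ox] := set_valP x.
    by exists (val @^-1` G) => //; exists G.
  have cT : countable [set: set_type U].
    rewrite -U'2; apply: countable_bigcup_countable => // u /U'1[G [_ /countable_injP[i iinj]] <-].
    apply/countable_injP; exists (i \o val).
    by move=> x y /set_mem Ox /set_mem Oy /= /iinj; rewrite !inE => /(_ Ox Oy)/val_inj.
  apply: (sub_countable _ (countable_image val cT)).
  by apply: subset_card_le => x Ux; exists (SigSub (mem_set Ux)).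
suff -> : [set: X] = U by [].
apply/esym/seteqP; split=> // x0 _; apply: contrapT => nUx0.
have [x [/set_mem nUx [V Vx VU]]] := sX (~` U) (ex_intro _ x0 nUx0).
apply: nUx; exists V°; last by rewrite /interior.
split; first exact: open_interior.
apply: (sub_countable _ (countableU cU (@countable1 _ x))).
apply: subset_card_le => y /interior_subset Vy.
have [Uy|nUy] := pselect (U y); [by left|right].
by rewrite -VU.
Qed.

(** * The theorem *)

Section Final.
Context {R : realType} {d : Order.disp_t} {W : orderType d}.
Hypothesis HW : is_omega1 W.
Local Notation C := R[i].
Local Notation N := (@modc R).
Local Notation P := (prod_topology (fun _ : option W => R[i]^o : topologicalType)).
Implicit Types (a b c : W) (p q x y : P) (D : W -> @stage_data R d W).
Variable dia : W -> set W.
Hypothesis diaP : diamond_sequence dia.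
Local Notation guess := (guess HW diaP).
Local Notation guessed := (@guessed R d W guess).
Local Notation regular := (@regular R d W HW guess).

(** Each of the countably many pairs is told apart at some stage. In [perfect_contains_fibre] this
    keeps truncation injective on the dense set, so its image has no isolated points. *)
Lemma separating_stage (F : set P) : countable F ->
  exists a, forall p q, F p -> F q -> tr a p = tr a q -> p = q.
Proof.
move=> cF; have /choice[b bP] (pq : P * P) :
    exists b, tr b pq.1 = tr b pq.2 -> pq.1 = pq.2.
  have [b0 _] := countable_bounded HW (@countable0 W).
  have [e|ne] := pselect (pq.1 = pq.2); first by exists b0.
  apply: contrapT => nb; apply: ne; apply: (tr_all_eq HW) => a; apply: contrapT => h.
  by apply: nb; exists a => /h.
have [a ha] := countable_bounded HW (countable_image b (countableX cF cF)).
exists a => p q Fp Fq pq; apply: (bP (p, q)); apply: tr_eq_le pq.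
by apply/ltW/ha; exists (p, q).
Qed.

Variable D : W -> @stage_data R d W.
Hypothesis rD : regular D.
Hypothesis candP : forall a, (exists x, candidate guess D a x) ->
  exists2 x, (D a).1 x & closure (guessed D a) x.

Lemma guessed_points_countable a :
  countable [set x | tower (restr D a) x /\ exists2 c, (c <= a)%O & guessed D c (tr c x)].
Proof.
have rDa : regular (restr D a) by apply: regular_restr => b _; exact: rD.
rewrite (_ : [set x | _] = \bigcup_(c in [set c | (c <= a)%O])
    [set x | tower (restr D a) x /\ guessed D c (tr c x)]); last first.
  by apply/seteqP; split=> [x [tx [c ca gx]]|x [c ca [tx gx]]]; [exists c|split=> //; exists c].
apply: countable_bigcup_countable => [|c ca]; first exact: countable_le.
have /countable_injP[i iinj] := guessed_countable HW diaP D c.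
apply/countable_injP; exists (i \o tr c) => x y /set_mem[tx gx] /set_mem[ty gy] /= h.
apply: (unique_lift rDa tx ty (c := c)); last by rewrite guessed_restr.
by apply: iinj => //; exact/mem_set.
Qed.

Lemma perfect_contains_fibre (E : set P) : E `<=` tower D -> E !=set0 -> closed E ->
  (forall p U, E p -> nbhs p U -> exists q, [/\ q <> p, E q & U q]) ->
  exists a x, [/\ (D a).1 x, tower (restr D a) x &
    forall p, tower D p -> tr a p = x -> E p].
Proof.
move=> ED [e0 Ee0] cE pE.
have [F [cF FE EF]] := tower_hereditarily_separable rD ED.
have F0 : F !=set0 by have [f [Ff _]] := EF _ Ee0 _ filterT; exists f.
have FD : F `<=` tower D by exact: subset_trans FE ED.
have [a0 sep] := separating_stage cF.
have [a [a0a gE]] := guess_countable HW diaP a0 cF F0 FD.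
have rDa : regular (restr D a) by apply: regular_restr => b _; exact: rD.
have clS : closure (tr a @` F) `<=` tower (restr D a).
  rewrite [X in _ `<=` X](iffLR (closure_id _) (tower_closed rDa)).
  by apply: closureS => _ [f /FD/tower_tr h <-].
have S0 : tr a @` F !=set0 by have [f Ff] := F0; exists (tr a f); exists f.
have cS : compact (closure (tr a @` F)).
  by apply: subclosed_compact (tower_compact rDa) clS; exact: closed_closure.
have [|x clx nBx] := dense_in_itself_avoid S0 cS (guessed_points_countable a).
  move=> _ U [f Ff <-] sU.
  have [q [qf Eq Uq]] := pE f _ (FE _ Ff) (nbhs_interior (tr_nbhs sU)).
  have [f' [Ff' [Uf' f'f]]] := EF q Eq _ (filterI Uq (nbhs_neq qf)).
  exists (tr a f'); first by exists f'.
  by split=> // /(tr_eq_le (ltW a0a))/(sep f' f Ff' Ff).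
(* The point [x] found by category only shows that a candidate exists; the point [x0] actually split
   may be another one. Being in the closure of the guessed set suffices for its whole fibre to lie
   in [E]. *)
have [|x0 Sx0 clx0] := candP (a := a).
  exists x; split; [exact: clS|by rewrite gE|].
  by move=> c ca gx; apply: nBx; split; [exact: clS|exists c].
have [h1 _ _ _ _ _ _] := rD a; have [tx0 _ _] := h1 _ Sx0.
exists a, x0; split=> // p tp px0.
rewrite (iffLR (closure_id _) cE); apply: (closureS FE).
by apply: (guessed_closure rD FD gE tp); rewrite -gE px0.
Qed.

Local Notation X := (set_type (tower D)).

Lemma tower_hausdorff : hausdorff_space X.
Proof. exact/set_type_hausdorff/hausdorff_prod_complex. Qed.

Lemma fibre_connected a x : connected [set z : X | tr a (val z) = x].
Proof.
move=> B [b0 Bb0] [G1 oG1 BG1] [G2 cG2 BG2]; apply: contrapT => nB.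
set Fb := [set z : X | _] in BG1 BG2 nB *.
have cFb : closed Fb.
  apply: (@preimage_closed _ _ (val : X -> P) [set p | tr a p = x]); last exact: tr_fibre_closed.
  by move=> z _; exact: set_type_val_continuous.
have [y [Fy nBy]] : exists z : X, Fb z /\ ~ B z.
  apply: contrapT => ny; apply: nB; apply/seteqP; split=> z.
    by rewrite BG1 => -[].
  by move=> Fz; apply: contrapT => nBz; apply: ny; exists z.
have cD := tower_compact rD.
have cl1 : closed B by rewrite BG2; exact: closedI.
have cl2 : closed (Fb `&` ~` G1) by apply: closedI => //; exact: open_closedC.
have [|||p [[z1 Bz1 <-] [z2 [Fz2 nz2] /val_inj z21]]] := fibre_inseparable (a := a) (x := x) rD
    (set_type_image_compact cD cl1) (set_type_image_compact cD cl2).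
- by exists (val b0), b0.
- exists (val y), y => //; split=> // Gy; apply: nBy; by rewrite BG1.
- apply/seteqP; split=> [p [[z Bz <-]|[z [Fz _] <-]]|p [tp px]].
  + by move: Bz; rewrite BG1 => -[Fz _]; split=> //; exact: set_valP.
  + by split=> //; exact: set_valP.
  + pose z : X := SigSub (mem_set tp).
    have [Gz|nGz] := pselect (G1 z); [left|right]; exists z => //.
    by rewrite BG1.
by apply: nz2; rewrite z21; move: Bz1; rewrite BG1 => -[].
Qed.

Lemma tower_HS : hereditarily_separable X.
Proof.
by apply: set_type_hereditarily_separable => E; apply: (tower_hereditarily_separable rD).
Qed.

Lemma tower_HL : hereditarily_lindelof X.
Proof.
apply: set_type_hereditarily_lindelof; first exact: tower_closed rD.
by move=> Z ZK cZ; exact: (tower_open_sigma_compact rD).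
Qed.

Lemma tower_not_countable : ~ countable [set: X].
Proof.
move=> cX; pose f (z : X) : R := complex.Re (val z None).
have cf := countable_image f cX.
have /countable_lebesgue_measure0 : countable (`[-1, 1]%classic : set R).
  apply: sub_countable cf; apply: subset_card_le => r; rewrite /= in_itv/= => r1.
  exists (SigSub (mem_set (sec_tower HW D (acos r)))) => //.
  by rewrite -[f _]/(complex.Re (sec HW D (acos r) None)) sec_None/= acosK.
rewrite lebesgue_measure_itv/= lte_fin; case: ifP => [_|]; last by rewrite gtrN.
by rewrite -EFinD => /eqP; rewrite eqe opprK -(natrD _ 1 1) pnatr_eq0.
Qed.

Lemma tower_weird : weird X.
Proof.
have cD := tower_compact rD.
split; first exact: set_type_compact.
  by move=> sX; apply: tower_not_countable; exact: scattered_lindelof_countable tower_HL.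
move=> [E [[e0 Ee0] [cE pE] tdE]].
have [||||a [x [Sx tx xE]]] := @perfect_contains_fibre (val @` E).
- by move=> _ [z _ <-]; exact: set_valP.
- by exists (val e0), e0.
- apply: compact_closed; first exact: hausdorff_prod_complex.
  exact: set_type_image_compact.
- move=> _ U [z Ez <-] zU; have : limit_point E z by rewrite pE.
  move=> /(_ _ (set_type_val_continuous zU))[y [yz Ey Uy]].
  exists (val y); split=> //; last by exists y.
  by move=> /val_inj yz'; rewrite yz' eqxx in yz.
have pt (s : C) : unit_interval s -> exists z : X, tr a (val z) = x /\ val z (Some a) = s.
  move=> sI; have [q [tq qx qs]] := fibre_point HW tx Sx sI.
  by exists (SigSub (mem_set tq)).
have [z0 [z0x z00]] := pt 0 unit_interval0.
have [z1 [z1x z11]] : exists z : X, tr a (val z) = x /\ val z (Some a) = 1.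
  by apply: pt; split=> //=; rewrite lexx ler01.
have Ez z : tr a (val z) = x -> E z.
  by move=> zx; have [y Ey /val_inj <-] := xE _ (set_valP z) zx.
have : connected_component E z0 z1.
  by exists [set z : X | tr a (val z) = x] => //; split=> //; exact: fibre_connected.
rewrite tdE; last exact: Ez.
move=> /= z10; move: z11; rewrite z10 z00 => /eqP; by rewrite eq_sym oner_eq0.
Qed.

Let secX (t : R) : X := SigSub (mem_set (sec_tower HW D t)).

(** It contains the coordinates and hence separates points. Taking all continuous functions with
    this pullback makes the algebra axioms immediate from the closure properties of
    [bounded_limit_closure]. *)
Definition analytic_algebra : set (X -> R[i]^o) :=
  [set f : X -> R[i]^o | continuous f /\
     bounded_limit_closure (fun t => f (secX t) : R[i])].

Lemma coordinate_continuous i : continuous (fun z : X => val z i : R[i]^o).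
Proof.
move=> z A /nbhs_modcP[e e0 eA]; apply/set_type_nbhsP.
exists [set q : P | N (q i - (val z : P) i) < e]; split; first exact: nbhs_coord.
by move=> w h; exact: eA.
Qed.

Lemma tower_not_CSWP : ~ CSWP R X.
Proof.
move=> cswp.
have alg : is_subalgebra analytic_algebra.
  split.
  - by move=> f [].
  - split; last exact: BLC_const.
    by move=> x; exact: cst_continuous.
  - move=> f g [cf hf] [cg hg]; split; last exact: BLC_add.
    by move=> x; apply: continuousD; [exact: cf|exact: cg].
  - move=> c f [cf hf]; split; last exact: (BLC_mul (BLC_const c) hf).
    by move=> x; apply: continuousZr; exact: cf.
  - move=> f g [cf hf] [cg hg]; split; last exact: BLC_mul.
    by move=> x; apply: continuousM; [exact: cf|exact: cg].
have sep : separates_points analytic_algebra.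
  move=> x y xy; have [i xyi] : exists i, val x i <> val y i.
    apply: contrapT => ni; move/eqP: xy; apply; apply: val_inj; apply/funext => i.
    by apply: contrapT => h; apply: ni; exists i.
  exists (fun z => val z i); last exact/eqP.
  split; first exact: coordinate_continuous.
  case: i {xyi} => [a|]; first by have [] := analytic_Some a rD.
  by have [] := analytic_None HW D.
have con : contains_constants analytic_algebra.
  by move=> c; split; [move=> x; exact: cst_continuous|exact: BLC_const].
pose f (z : X) : R[i]^o := (val z None)^*%C.
have Nconj (u v : C) : N (u^*%C - v^*%C) = N (u - v).
  by rewrite -rmorphB /modc; case: (u - v) => r s /=; rewrite sqrrN.
have cf : continuous f.
  move=> z A /nbhs_modcP[e e0 eA]; apply/set_type_nbhsP.
  exists [set q : P | N (q None - (val z : P) None) < e]; split; first exact: nbhs_coord.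
  by move=> w h; apply: eA; rewrite /f Nconj.
have [g [cg hg] fg1] := cswp _ alg sep con f cf 1 ltr01.
have cfg : cont_on [set: X] (fun z => f z - g z : C).
  move=> z _ e e0; have : continuous (fun z => f z - g z : R[i]^o).
    by move=> x; apply: continuousB; [exact: cf|exact: cg].
  move=> /(_ z [set w | N (w - (f z - g z)) < e]) h.
  have : nbhs z [set w : X | N (f w - g w - (f z - g z)) < e].
    by apply: h; apply/nbhs_modcP; exists e.
  by apply: filterS.
have [M hM] := compact_modc_bounded (set_type_compact (tower_compact rD)) cfg.
(* Along the section [f] is the conjugate of [circ t]. Passing from the supremum norm to the value
   at [t] uses that the range is bounded, which [M] provides. *)
apply: (BLC_dist_conj hg fg1) => t.
rewrite -(sec_None HW D t); apply: sup_upper_bound; last by exists (secX t).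
split; first by exists (N (f (secX 0) - g (secX 0))), (secX 0).
by exists M => _ [z _ <-]; exact: hM.
Qed.

End Final.

Theorem theorem1p6 (R : realType) :
  Jensen_diamond ->
  exists X : topologicalType,
    [/\ hausdorff_space X, weird X, hereditarily_separable X,
        hereditarily_lindelof X & ~ CSWP R X].
Proof.
move=> [d [W [HW [dia diaP]]]].
have [D [rD candP]] := tower_exists (R := R) HW (guess HW diaP).
exists (set_type (tower D)); split.
- exact: tower_hausdorff.
- exact: (tower_weird rD candP).
- exact: (tower_HS rD).
- exact: (tower_HL rD).
- exact: (tower_not_CSWP rD).
Qed.
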